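(* Let $B_t=(X_t,Y_t)$, $t\in[0,1]$, be a two-dimensional Brownian motion starting at $0$, and let $\mathcal{A}=\frac12\int_0^1 (X_s\,dY_s-Y_s\,dX_s)$ be its L\'evy area at time $1$. Then for every integer $n\ge 0$, $$\mathbb{E}\,\mathcal{A}^n = 2^{-n}E_n,$$ where $E_n$ is the $n$th Euler number.
   Context: Brownian motion is standard: $X$ and $Y$ are independent standard one-dimensional Brownian motions. The integral defining $\mathcal{A}$ is a stochastic integral. The Euler numbers $E_n$ are defined by the generating function $\sum_{n=0}^\infty E_n \frac{z^n}{n!}=(\cos z)^{-1}$, so $E_0=1$, $E_2=1$, $E_4=5$, $E_6=61$, and $E_n=0$ for odd $n$. *)

(* Defs.v *)
From HB Require Import structures.
From mathcomp Require Import all_boot all_order all_algebra.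
From mathcomp Require Import all_classical all_reals all_analysis.
Set Implicit Arguments.
Unset Strict Implicit.
Unset Printing Implicit Defensive.
Import Order.TTheory GRing.Theory Num.Theory.
Import numFieldNormedType.Exports.
Local Open Scope classical_set_scope.
Local Open Scope ring_scope.

Section Independence.
Context {R : realType} {d : measure_display} {T : measurableType d}.
Variable P : probability T R.

(* The sets V i range over all measurable sets, setT included, so the product
   rule for every subfamily is covered. *)
Definition mutually_independent (n : nat) (Z : 'I_n -> T -> R) : Prop :=
  forall V : 'I_n -> set R, (forall i, measurable (V i)) ->
    P (\bigcap_i (Z i @^-1` V i)) = (\prod_(i < n) P (Z i @^-1` V i))%E.

Definition independent_classes (F G : set (set T)) : Prop :=
  forall A B, F A -> G B -> P (A `&` B) = (P A * P B)%E.

End Independence.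

Section Brownian.
Context {R : realType} {d : measure_display} {T : measurableType d}.

Definition sigma_process (D : set R) (X : R -> T -> R) : set (set T) :=
  <<s \bigcup_(t in D) preimage_set_system setT (X t) measurable >>.

Definition natural_filtration2 (X Y : R -> T -> R) (t : R) : set (set T) :=
  <<s sigma_process `[0, t] X `|` sigma_process `[0, t] Y >>.

Definition subdivision (n : nat) (t : nat -> R) : Prop :=
  [/\ 0 <= t 0%N, (forall i, (i < n)%N -> t i <= t i.+1) & t n <= 1].

Variable P : probability T R.

(* Only the times in [0, 1] are constrained. The second parameter of
   normal_prob is the standard deviation. *)
Definition standard_brownian_motion (X : R -> {RV P >-> R}) : Prop :=
  [/\ {ae P, forall w, X 0 w = 0},
      (forall n t, subdivision n t ->
        mutually_independent P (fun (i : 'I_n) w => X (t i.+1) w - X (t i) w)),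
      (forall s t : R, 0 <= s -> s < t -> t <= 1 ->
        forall V : set R, measurable V ->
          P ((fun w => X t w - X s w) @^-1` V)
          = normal_prob 0 (Num.sqrt (t - s)) V) &
      {ae P, forall w, {within `[0, 1], continuous (fun t : R => X t w : R)}}].

Definition brownian_motion2 (X Y : R -> {RV P >-> R}) : Prop :=
  [/\ standard_brownian_motion X, standard_brownian_motion Y &
      independent_classes P (sigma_process `[0, 1] X) (sigma_process `[0, 1] Y)].

End Brownian.

Section ItoIntegral.
Context {R : realType} {d : measure_display} {T : measurableType d}.

(* sum_(i < n) xi_i 1_(]t_i, t_(i+1)]) with xi_i bounded and F_(t_i)-measurable *)
Record simple_process (F : R -> set (set T)) := SimpleProcess {
  sp_size : nat;
  sp_time : nat -> R;
  sp_coef : nat -> T -> R;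
  sp_subdivision : subdivision sp_size sp_time;
  sp_bounded : forall i, (i < sp_size)%N ->
    exists M : R, forall w, `|sp_coef i w| <= M;
  sp_adapted : forall i, (i < sp_size)%N ->
    forall V : set R, measurable V -> F (sp_time i) (sp_coef i @^-1` V)
}.

Definition sp_val F (H : simple_process F) (s : R) (w : T) : R :=
  \sum_(i < sp_size H)
    sp_coef H i w * \1_(`]sp_time H i, sp_time H i.+1]) s.

Definition sp_integral F (H : simple_process F) (W : R -> T -> R) (w : T) : R :=
  \sum_(i < sp_size H)
    sp_coef H i w * (W (sp_time H i.+1) w - W (sp_time H i) w).

(* I is (a version of) the Ito integral int_0^1 H dW with respect to the
   filtration F: H is the limit, in L^2 of ds (x) P on [0, 1] x Omega, of simple
   F-predictable processes whose elementary integrals converge to I in L^2(P).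
   By the Ito isometry the limit does not depend on the approximating sequence,
   up to almost sure equality. *)
Definition is_ito_integral (P : probability T R) (F : R -> set (set T))
    (H W : R -> T -> R) (I : T -> R) : Prop :=
  exists Hk : nat -> simple_process F,
    (\int[lebesgue_measure]_(s in `[0%R, 1%R])
       'E_P[fun w => ((H s w - sp_val (Hk k) s w) ^+ 2)%R])%E @[k --> \oo] --> 0%E /\
    ('E_P[fun w => ((I w - sp_integral (Hk k) W w) ^+ 2)%R])%E @[k --> \oo] --> 0%E.

Definition is_levy_area (P : probability T R) (X Y : R -> {RV P >-> R})
    (A : {RV P >-> R}) : Prop :=
  exists I J : {RV P >-> R},
    [/\ is_ito_integral P (natural_filtration2 X Y) X Y I,
        is_ito_integral P (natural_filtration2 X Y) Y X J &
        {ae P, forall w, A w = 2^-1 * (I w - J w)}].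

End ItoIntegral.

(* The generating function identity determines the sequence E. *)
Definition euler_numbers {R : realType} (E : nat -> R) : Prop :=
  \forall z \near (0 : R), pseries (fun n => E n / n`!%:R) z @ \oo --> (cos z)^-1.

(* Main.v *)
(* The moment generating function of the area is computed on the grid i/N. Let
   A_N be the area of the polygonal path, h = 1/N, and write x, y, a for the
   position and the area at a grid time. Integrating out the two Gaussian
   increments of one step sends exp(z a' + c (x'^2 + y'^2)) to
   (1 - 2ch)^-1 exp(z a + c' (x^2 + y^2)) with c' = (c + z^2 h/8) / (1 - 2ch).
   Writing c = p/q linearizes this Riccati recursion and gives
   E exp(z A_N) = 1 / Re (1 + i z/(2N))^N, which tends to 1 / cos(z/2).
   By the Ito isometry A_N tends to A in L^2, and the uniform exponential
   moments turn this into E exp(z A) = 1 / cos(z/2) for small real z. Both sides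
   are power series in z, and comparing coefficients yields the moments. *)
From HB Require Import structures.
Require Import Defs.
From mathcomp Require Import all_boot all_order all_algebra.
From mathcomp Require Import all_classical all_reals all_analysis.
From mathcomp Require Import measurable_realfun ring lra.
Set Implicit Arguments.
Unset Strict Implicit.
Unset Printing Implicit Defensive.
Import Order.TTheory GRing.Theory Num.Theory.
Import numFieldNormedType.Exports.
Local Open Scope classical_set_scope.
Local Open Scope ring_scope.

(** * Independence of the past and the increments *)

(** The stochastic integrals are known only as L^2 limits of arbitrary simple processes, so their
    definition is used for one thing: the bound E (A - A_N)^2 <= 4/N. It comes from comparing a
    simple process with the grid interpolation of the path inside a single elementary sum. The form
    exp(z a + c (x^2 + y^2)) is stable because the law of a planar Gaussian increment is rotation
    invariant, so only the squared radius survives a step. All Gaussian facts come from the integral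
    of the exponential of a quadratic polynomial. Mean and variance are read off it through 1 + x <=
    exp x, without differentiating under the integral. Two constraints fix the range of z. For |z|
    <= 1 the denominators q stay above 3/4, which bounds the exponential moments of every A_N by
    4/3; convergence at z uses this bound at 2z. Hence |z| <= 1/2, which suffices for comparing
    coefficients at 0. *)

Section Independence.
Context {R : realType} {d : measure_display} {T : measurableType d}.
Variable P : probability T R.

Lemma independent_classesC (F G : set (set T)) :
  independent_classes P F G -> independent_classes P G F.
Proof. by move=> FG A B GA FB; rewrite setIC muleC; exact: FG. Qed.

(** For fixed [B] in [G] the sets [A] with P(A B) = P(A) P(B) form a Dynkin system; it contains the
    pi-system [F], hence the sigma-algebra that [F] generates. *)
Lemma independent_classes_sigma (F G : set (set T)) :
  setI_closed F -> F `<=` measurable -> G `<=` measurable ->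
  independent_classes P F G -> independent_classes P <<s F >> G.
Proof.
move=> FI mF mG FG A B FA GB; have mB := mG _ GB.
have sFm : <<s F >> `<=` measurable.
  exact: (smallest_sub (@sigma_algebra_measurable _ T) mF).
have fP C : measurable C -> P C \is a fin_num by move=> ?; exact: fin_num_measure.
suff : <<s F >> `<=` [set A | measurable A /\ P (A `&` B) = (P A * P B)%E].
  by move=> /(_ _ FA)[].
apply: lambda_system_subset => //; last first.
  by move=> C FC; split; [exact: mF|exact: FG].
apply/dynkin_lambda_system; split.
- by split => //; rewrite setTI probability_setT mul1e.
- move=> C [mC CB]; split; first exact: measurableC.
  have -> : ~` C `&` B = B `\` (C `&` B).
    by rewrite setDE setCI setIUr setICr setU0 setIC.
  rewrite measureD//; last 2 first.
    exact: measurableI.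
    by rewrite -ge0_fin_numE// fP.
  rewrite setICA setIid; transitivity (P B - P C * P B)%E.
    by congr (_ - _)%E; exact: CB.
  by rewrite probability_setC// muleBl ?mul1e// fP.
- move=> C tC mC; have mC' n := (mC n).1.
  split; first exact: bigcup_measurable.
  rewrite setI_bigcupl measure_bigcup//; last 2 first.
    by move=> k _; exact: measurableI.
    exact: trivIset_setIr.
  rewrite measure_bigcup// muleC -[X in (X * _)%E](fineK (fP _ mB)).
  rewrite -nneseriesZl//.
  apply: eq_eseriesr => k _; rewrite (fineK (fP _ mB)) muleC.
  exact: (mC k).2.
Qed.

End Independence.

Section RandomVariableSets.
Context {R : realType} {d : measure_display} {T : measurableType d}.
Variable P : probability T R.

Lemma measure_setI_ae (A N : set T) : measurable A -> measurable N ->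
  P.-negligible (~` N) -> P A = P (A `&` N).
Proof.
move=> mA mN N0; apply/eqP; rewrite eq_le; apply/andP; split; last first.
  by apply: le_measure; rewrite ?inE//; exact: measurableI.
rewrite -[X in (P X <= _)%E](setIT A) -(setUv N) setIUr.
have mN' := measurableC mN.
apply: (@le_trans _ _ (P (A `&` N) + P (A `&` ~` N))%E).
  by apply: measureU2; exact: measurableI.
have -> : P (A `&` ~` N) = 0%E.
  by apply: subset_measure0 (measure_negligible mN' N0) => //; exact: measurableI.
by rewrite adde0.
Qed.

Lemma measurable_preimage (Z : T -> R) (V : set R) :
  measurable_fun setT Z -> measurable V -> measurable (Z @^-1` V).
Proof. by move=> mZ mV; rewrite -[X in measurable X]setTI; exact: mZ. Qed.

End RandomVariableSets.

Section PastIncrements.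
Context {R : realType} {d : measure_display} {T : measurableType d}.
Variables (P : probability T R) (n : nat) (D : nat -> T -> R).
Hypothesis mD : forall i, measurable_fun setT (D i).

(** Rectangles in the first [n] variables, a pi-system generating their sigma-algebra. Indexing the
    sides by [nat] makes intersections componentwise. *)
Definition past_cylinders : set (set T) :=
  [set A | exists2 V : nat -> set R, (forall i, measurable (V i)) &
    A = \bigcap_(i in `I_n) (D i @^-1` V i)].

Lemma past_cylindersI : setI_closed past_cylinders.
Proof.
move=> _ _ [V mV ->] [V' mV' ->]; exists (fun i => V i `&` V' i).
  by move=> i; exact: measurableI.
by rewrite -bigcapI; apply: eq_bigcapr => i _; rewrite preimage_setI.
Qed.

Lemma past_cylinders_measurable : past_cylinders `<=` measurable.
Proof.
move=> _ [V mV ->]; apply: fin_bigcap_measurable; first exact: finite_II.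
by move=> i _; exact: measurable_preimage.
Qed.

Lemma past_cylinders_independent :
  mutually_independent P (fun i : 'I_n.+1 => D i) ->
  independent_classes P <<s past_cylinders >>
    (preimage_set_system setT (D n) measurable).
Proof.
move=> iD; apply: independent_classes_sigma.
- exact: past_cylindersI.
- exact: past_cylinders_measurable.
- by move=> _ [V mV <-]; rewrite setTI; exact: measurable_preimage.
- move=> _ _ [V mV ->] [B mB <-]; rewrite setTI.
  (* This is used twice: with [C] = [B], and with [C] = [setT] to identify the product over [i < n]
     with the probability of the rectangle. *)
  have key C : measurable C ->
      P (\bigcap_(i in `I_n) (D i @^-1` V i) `&` (D n @^-1` C)) =
      ((\prod_(i < n) P (D i @^-1` V i)) * P (D n @^-1` C))%E.
    move=> mC; pose V' i := if (i < n)%N then V i else C.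
    have mV' i : measurable (V' i) by rewrite /V'; case: ifP.
    have := iD (fun i : 'I_n.+1 => V' i) (fun i => mV' i).
    rewrite big_ord_recr/=.
    have -> : V' n = C by rewrite /V' ltnn.
    under eq_bigr do rewrite /V' ltn_ord.
    move=> <-; congr (P _); apply/seteqP; split => w /=.
      move=> [VD CD] i _; rewrite /V'; case: ifPn => [|ni]; first exact: VD.
      have -> // : nat_of_ord i = n.
      by apply/eqP; rewrite eqn_leq -ltnS ltn_ord leqNgt.
    move=> VD; split => [i /= ni|].
      by have := VD (Ordinal (ltnW ni : (i < n.+1)%N)) I; rewrite /V'/= ni.
    by have := VD ord_max I; rewrite /V'/= ltnn.
  rewrite key//; congr (_ * _)%E.
  by have := key setT measurableT; rewrite preimage_setT setIT probability_setT mule1.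
Qed.

(** Each [D i] is measurable because its preimages are rectangles with all other sides full. The
    partial sums are what W r - W 0 telescopes to. *)
Lemma past_sum_measurable k : (k <= n)%N ->
  measurable_fun [set: g_sigma_algebraType past_cylinders]
    (fun w => \sum_(i < k) D i w).
Proof.
move=> kn; apply: measurable_sum => i _ V mV; rewrite setTI.
apply: sub_sigma_algebra.
exists (fun j => if j == i :> nat then V else setT).
  by move=> j; case: ifP.
apply/seteqP; split => w /= Vw.
  by move=> j jn /=; case: eqP => // ->.
by have := Vw i (leq_trans (ltn_ord i) kn); rewrite /= eqxx.
Qed.

End PastIncrements.

Section BrownianIncrements.
Context {R : realType} {d : measure_display} {T : measurableType d}.
Variables (P : probability T R) (W : R -> {RV P >-> R}).
Hypothesis hW : standard_brownian_motion W.

(** The sides are indexed by the time itself, not by its position in [s]: repeated times do no harm,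
    and two cylinders intersect by concatenating their lists. *)
Definition cylinders (t : R) : set (set T) :=
  [set A | exists s : seq R, exists2 V : R -> set R,
    all (fun r => 0 <= r <= t) s /\ (forall r, measurable (V r)) &
    A = \bigcap_(r in [set` s]) (W r @^-1` V r)].

Lemma cylindersI t : setI_closed (cylinders t).
Proof.
move=> _ _ [s [V [st mV] ->]] [s' [V' [st' mV'] ->]].
exists (s ++ s'), (fun r => (if r \in s then V r else setT) `&`
  (if r \in s' then V' r else setT)).
  split; first by rewrite all_cat st st'.
  by move=> r; apply: measurableI; case: ifP.
apply/seteqP; split => w /=.
  move=> [Vw Vw'] r /=; rewrite mem_cat => _.
  by split; case: ifPn => // rs; [exact: Vw|exact: Vw'].
move=> Vw; split => r /= rs; have := Vw r; rewrite /= mem_cat rs ?orbT.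
  by move=> /(_ isT)[].
by move=> /(_ isT)[].
Qed.

Lemma cylinders_measurable t : cylinders t `<=` measurable.
Proof.
move=> _ [s [V [_ mV] ->]]; apply: fin_bigcap_measurable => // r _.
exact: measurable_preimage.
Qed.

Lemma sigma_process_cylinders t :
  sigma_process `[0, t] W `<=` <<s cylinders t >>.
Proof.
apply: smallest_sub; first exact: smallest_sigma_algebra.
move=> A [r /= rt [V mV <-]]; apply: sub_sigma_algebra.
exists [:: r], (fun=> V); first by move: rt; rewrite in_itv/= andbT.
apply/seteqP; split => w /=.
  by move=> [_ Vw] q /=; rewrite mem_seq1 => /eqP ->.
by move=> /(_ r); rewrite /= mem_seq1 eqxx => /(_ isT).
Qed.

Definition increment (s t : R) (w : T) : R := W t w - W s w.

Lemma measurable_increment s t : measurable_fun setT (increment s t).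
Proof. exact: measurable_funB. Qed.

(* Since W 0 = 0 holds only almost surely, W r is first replaced by W r - W 0, a
   sum of increments. *)
Lemma cylinders_independent t u : 0 <= t -> t <= u -> u <= 1 ->
  independent_classes P (cylinders t)
    (preimage_set_system setT (increment t u) measurable).
Proof.
move=> t0 tu u1 _ _ [s [V [st mV] ->]] [B mB <-]; rewrite setTI.
have [W0 iW _ _] := hW.
(* All observed times, sorted, become one subdivision whose last step is from [t] to [u]. With the
   leading 0, the time [t] has index [n] = size s + 1. *)
pose L := 0 :: sort <=%R s ++ [:: t; u].
pose tau i := nth u L i.
pose n := (size s).+1.
pose D i := increment (tau i) (tau i.+1).
have tau0 : tau 0 = 0 by [].
have taun : tau n = t by rewrite /tau/= nth_cat size_sort ltnn subnn.
have taun1 : tau n.+1 = u.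
  by rewrite /tau/= nth_cat size_sort ltnNge leqnSn/= subSnn.
have sub : subdivision n.+1 tau.
  split => //; last by rewrite taun1.
  have : sorted <=%R L.
    rewrite /L/= cat_path /= tu andbT; apply/andP; split.
      rewrite path_min_sorted ?sort_le_sorted//.
      by apply/allP => r; rewrite mem_sort => /(allP st)/andP[].
    rewrite andbT; have lt_t x : x \in 0 :: sort <=%R s -> x <= t.
      rewrite inE => /orP[/eqP->//|]; rewrite mem_sort => /(allP st)/andP[_].
      by [].
    by apply: lt_t; exact: mem_last.
  move=> /(sortedP u) sL i iln; apply: sL.
  by rewrite /L/= size_cat size_sort/= addn2 ltnS.
have mD i : measurable_fun setT (D i) by exact: measurable_increment.
have ind := past_cylinders_independent mD
  (iW _ _ sub : mutually_independent P (fun i : 'I_n.+1 => D i)).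
pose N0 := W 0 @^-1` [set 0].
have mN0 : measurable N0 by exact: measurable_preimage.
pose A := \bigcap_(r in [set` s]) (W r @^-1` V r).
pose A' := \bigcap_(r in [set` s]) (increment 0 r @^-1` V r).
have mA : measurable A by apply: (@cylinders_measurable t); exists s, V.
have AA' : A `&` N0 = A' `&` N0.
  rewrite /A /A' /N0; apply/seteqP; split => w /= [Aw w0]; split => // r rs.
    by have := Aw r rs; rewrite /= /increment w0 subr0.
  by have := Aw r rs; rewrite /= /increment w0 subr0.
have sA' : <<s past_cylinders n D >> A'.
  rewrite -[X in X A']/(@measurable _ (g_sigma_algebraType (past_cylinders n D))).
  apply: fin_bigcap_measurable => // r rs.
  have [k kn rk] : exists2 k, (k <= n)%N & r = tau k.
    exists (index r (sort <=%R s)).+1.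
      by rewrite ltnS -[X in (_ <= X)%N](size_sort <=%R) index_size.
    have rs' : r \in sort <=%R s by rewrite mem_sort.
    by rewrite /tau/= nth_cat index_mem rs' nth_index.
  have -> : increment 0 r @^-1` V r =
      (fun w => \sum_(i < k) D i w) @^-1` V r.
    apply/seteqP.
    have E w : \sum_(i < k) D i w = increment 0 r w.
      rewrite -(big_mkord predT (fun i => D i w)).
      by rewrite telescope_sumr// -rk tau0.
    by split => w /=; rewrite E.
  by rewrite -[X in measurable X]setTI; exact: past_sum_measurable.
have mA' : measurable A'.
  have sm : <<s past_cylinders n D >> `<=` measurable.
    apply: smallest_sub; first exact: (@sigma_algebra_measurable _ T).
    exact: past_cylinders_measurable.
  exact: sm.
have mB' := measurable_preimage (measurable_increment t u) mB.
rewrite (measure_setI_ae (measurableI _ _ mA mB') mN0 W0).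
rewrite setIAC AA' setIAC -(measure_setI_ae (measurableI _ _ mA' mB') mN0 W0).
rewrite (measure_setI_ae mA mN0 W0) AA' -(measure_setI_ae mA' mN0 W0).
by apply: ind => //; exists B => //; rewrite setTI /D taun taun1.
Qed.

Lemma bm_increment_independent t u : 0 <= t -> t <= u -> u <= 1 ->
  independent_classes P (sigma_process `[0, t] W)
    (preimage_set_system setT (increment t u) measurable).
Proof.
move=> t0 tu u1 A B /sigma_process_cylinders; move: A B.
apply: independent_classes_sigma.
- exact: cylindersI.
- exact: cylinders_measurable.
- by move=> _ [V mV <-]; rewrite setTI;
  exact: measurable_preimage (measurable_increment t u) mV.
- exact: cylinders_independent.
Qed.

Lemma sub_sigma_process (D D' : set R) :
  D `<=` D' -> sigma_process D W `<=` sigma_process D' W.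
Proof.
move=> DD'; apply: smallest_sub; first exact: smallest_sigma_algebra.
by move=> A [r Dr rA]; apply: sub_sigma_algebra; exists r => //; exact: DD'.
Qed.

Lemma sigma_process_measurable (D : set R) : sigma_process D W `<=` measurable.
Proof.
apply: smallest_sub; first exact: (@sigma_algebra_measurable _ T).
by move=> A [r _ [V mV <-]]; rewrite setTI; exact: measurable_preimage.
Qed.

Lemma measurable_fun_sigma_process (D : set R) r : D r ->
  measurable_fun [set: g_sigma_algebraType
    (\bigcup_(t in D) preimage_set_system setT (W t) measurable)] (W r).
Proof.
move=> Dr _ V mV; apply: sub_sigma_algebra; exists r => //; exists V => //.
Qed.

Lemma sigma_process_increment t s V : 0 <= t <= 1 -> 0 <= s <= 1 ->
  measurable V -> sigma_process `[0, 1] W (increment t s @^-1` V).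
Proof.
move=> t01 s01 mV; rewrite -[X in _ X]setTI.
have H r (r01 : 0 <= r <= 1) : r \in `[0, 1] by rewrite in_itv.
apply: (@measurable_funB _ (g_sigma_algebraType _)) => //;
  apply: measurable_fun_sigma_process; exact: H.
Qed.

End BrownianIncrements.

Section Planar.
Context {R : realType} {d : measure_display} {T : measurableType d}.
Variables (P : probability T R).
Implicit Types X Y : R -> {RV P >-> R}.

(** The two horizons differ because a step of the area integrates out the increment of Y while X is
    already known up to the end of the step. *)
Definition filtration_generator X Y (a b : R) : set (set T) :=
  sigma_process `[0, a] X `|` sigma_process `[0, b] Y.

Lemma filtration_generatorC X Y a b :
  filtration_generator X Y a b = filtration_generator Y X b a.
Proof. exact: setUC. Qed.

Lemma brownian_motion2C X Y : brownian_motion2 X Y -> brownian_motion2 Y X.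
Proof.
by move=> [hX hY XY]; split => //; exact: independent_classesC.
Qed.

(** On the pi-system of intersections of an X-event with a past Y-event, the independence of X and Y
    splits off the X-event, and the independence of the increments of Y splits the rest. The
    X-horizon [a] may therefore exceed [b]. *)
Lemma filtration_independent X Y a b u : brownian_motion2 X Y ->
  0 <= a <= 1 -> 0 <= b -> b <= u -> u <= 1 ->
  independent_classes P <<s filtration_generator X Y a b >>
    (preimage_set_system setT (increment Y b u) measurable).
Proof.
move=> [hX hY XY] /andP[a0 a1] b0 bu u1.
pose G := [set A1 `&` A2 | A1 in sigma_process `[0, a] X & A2 in sigma_process `[0, b] Y].
have sub1 t : t <= 1 -> `[0, t] `<=` `[0, 1 : R].
  by move=> t1 r /=; rewrite !in_itv/= => /andP[-> rt]; exact: le_trans t1.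
have sXI : setI_closed (sigma_process `[0, a] X).
  by move=> A B; exact: (@measurableI _ (g_sigma_algebraType _)).
have sYI : setI_closed (sigma_process `[0, b] Y).
  by move=> A B; exact: (@measurableI _ (g_sigma_algebraType _)).
have sG : <<s filtration_generator X Y a b >> `<=` <<s G >>.
  apply: smallest_sub; first exact: smallest_sigma_algebra.
  move=> A [AX|AY]; apply: sub_sigma_algebra.
    exists A => //; exists setT; last by rewrite setIT.
    exact: (@measurableT _ (g_sigma_algebraType _)).
  exists setT; last by exists A => //; rewrite setTI.
  exact: (@measurableT _ (g_sigma_algebraType _)).
move=> A B /sG; move: A B.
apply: independent_classes_sigma.
- move=> _ _ [A1 X1 [A2 Y2 <-]] [B1 X1' [B2 Y2' <-]].
  exists (A1 `&` B1); first exact: sXI.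
  by exists (A2 `&` B2); [exact: sYI|rewrite setIACA].
- move=> _ [A1 /sigma_process_measurable mA1 [A2 /sigma_process_measurable mA2 <-]].
  exact: measurableI.
- move=> _ [V mV <-]; rewrite setTI.
  exact: measurable_preimage (measurable_increment Y b u) mV.
- move=> _ _ [A1 X1 [A2 Y2 <-]] [B mB <-]; rewrite setTI -setIA.
  have X1' := sub_sigma_process (sub1 _ a1) X1.
  have Y2' := sub_sigma_process (sub1 _ (le_trans bu u1)) Y2.
  have dY : sigma_process `[0, 1] Y (increment Y b u @^-1` B).
    by apply: sigma_process_increment => //; apply/andP; split => //; lra.
  have Y2dY : sigma_process `[0, 1] Y (A2 `&` increment Y b u @^-1` B).
    exact: (@measurableI _ (g_sigma_algebraType _)).
  rewrite (XY _ _ X1' Y2dY) (XY _ _ X1' Y2') -muleA; congr (_ * _)%E.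
  apply: (bm_increment_independent hY b0 bu u1) => //.
  by exists B => //; rewrite setTI.
Qed.

End Planar.

(** * Gaussian integrals *)

Section Density.
Local Open Scope ereal_scope.
Context d (T : measurableType d) (R : realType).
Variables (mu nu : {measure set T -> \bar R}) (p : T -> R).
Hypotheses (mp : measurable_fun setT p) (p0 : forall x, (0 <= p x)%R).
Hypothesis nuE : forall A, measurable A -> nu A = \int[mu]_(x in A) (p x)%:E.

Import HBNNSimple.

Lemma ge0_integral_density (f : T -> \bar R) :
  measurable_fun setT f -> (forall x, 0 <= f x) ->
  \int[nu]_x f x = \int[mu]_x (f x * (p x)%:E).
Proof.
move=> mf f0; pose f_ := nnsfun_approx measurableT mf.
transitivity (limn (fun n => \int[nu]_x (f_ n x)%:E)).
  rewrite -monotone_convergence//.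
  - apply: eq_integral => y _; apply/esym/cvg_lim => //.
    exact: cvg_nnsfun_approx.
  - by move=> n; exact/measurable_EFinP/measurable_funP.
  - by move=> n y _; rewrite lee_fin.
  - by move=> y _ m n mn; rewrite lee_fin; exact/lefP/nd_nnsfun_approx.
transitivity (limn (fun n => \int[mu]_x ((f_ n x)%:E * (p x)%:E))); last first.
  rewrite -monotone_convergence//.
  - apply: eq_integral => y _; apply/cvg_lim => //.
    by apply: cvgeZr => //; exact: cvg_nnsfun_approx.
  - move=> n; apply: emeasurable_funM; exact/measurable_EFinP.
  - by move=> n y _; rewrite -EFinM lee_fin mulr_ge0.
  - move=> y _ m n mn; rewrite -!EFinM lee_fin ler_wpM2r//.
    exact/lefP/nd_nnsfun_approx.
congr (limn _); apply/funext => n.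
rewrite integralT_nnsfun sintegralE.
have -> : \int[mu]_x ((f_ n x)%:E * (p x)%:E) = \int[mu]_x
    \sum_(r \in range (f_ n)) (r * \1_(f_ n @^-1` [set r]) x * p x)%:E.
  apply: eq_integral => x _; rewrite fsumEFin// -EFinM; congr EFin.
  by rewrite [in LHS]fimfunE mulr_fsuml.
have ge0 : forall r x, 0 <= (r * \1_(f_ n @^-1` [set r]) x * p x)%:E.
  move=> r x; rewrite lee_fin mulr_ge0// indicE; case: (boolP (x \in _)); rewrite ?mulr0//.
  by rewrite inE /= mulr1 => <-.
rewrite ge0_integral_fsum//; last first.
  by move=> y; apply/measurable_EFinP; do 2! apply: measurable_funM => //.
apply: eq_fsbigr => r _.
(* Pulling the value [r] out of the integral needs [r] >= 0; the level sets of negative values are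
   empty since the simple functions are nonnegative. *)
have [r0|r0] := ltP r 0%R.
  have fr : f_ n @^-1` [set r] = set0.
    by apply/seteqP; split => x //= fx; move: r0; rewrite -fx ltNge fun_ge0.
  rewrite fr measure0 mule0 integral0_eq// => x _.
  by rewrite indicE in_set0 mulr0 mul0r.
have -> : \int[mu]_x (r * \1_(f_ n @^-1` [set r]) x * p x)%:E =
    \int[mu]_x (r%:E * (p x * \1_(f_ n @^-1` [set r]) x)%:E).
  by apply: eq_integral => x _; rewrite -EFinM mulrA (mulrC _ (p x)) mulrA -mulrA mulrCA mulrA.
rewrite ge0_integralZl_EFin//; last 2 first.
  by move=> x _; rewrite lee_fin mulr_ge0.
  by apply/measurable_EFinP; exact: measurable_funM.
rewrite nuE// [in LHS]integral_mkcond; congr (_ * _).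
apply: eq_integral => x _; rewrite patchE indicE.
by case: (x \in _); rewrite ?mulr1 ?mulr0.
Qed.

End Density.

Section GaussianIntegral.
Context {R : realType}.
Local Notation mu := (@lebesgue_measure R).

Lemma normal_integral (m s : R) (f : R -> \bar R) :
  measurable_fun setT f -> (forall x, 0 <= f x)%E ->
  (\int[normal_prob m s]_x f x = \int[mu]_x (f x * (normal_pdf m s x)%:E))%E.
Proof.
move=> mf f0; apply: ge0_integral_density => //.
- exact: measurable_normal_pdf.
- exact: normal_pdf_ge0.
Qed.

(** Completing the square. Writing the quadratic coefficient as (1 - u^2) / (2h) builds in the
    integrability condition c < 1 / (2h), and the tilted density has standard deviation sqrt h /
    u. *)
Lemma normal_pdf_tilt (h u th g : R) : 0 < h -> 0 < u ->
  expR (th * g + (1 - u ^+ 2) / (2 * h) * g ^+ 2) * normal_pdf 0 (Num.sqrt h) g =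
  u^-1 * expR (th ^+ 2 * h / (2 * u ^+ 2)) *
    normal_pdf (th * h / u ^+ 2) (Num.sqrt h / u) g.
Proof.
move=> h0 u0.
have sh0 : 0 < Num.sqrt h by rewrite sqrtr_gt0.
rewrite !normal_pdfE ?gt_eqF ?divr_gt0//.
rewrite /normal_peak /normal_fun.
have -> : Num.sqrt ((Num.sqrt h / u) ^+ 2 * pi *+ 2) =
    Num.sqrt ((Num.sqrt h) ^+ 2 * pi *+ 2) / u.
  have sqrt_div (a : R) : 0 <= a -> Num.sqrt (a / u ^+ 2) = Num.sqrt a / u.
    by move=> a0; rewrite sqrtrM// -exprVn sqrtr_sqr ger0_norm// invr_ge0 ltW.
  rewrite -(sqrt_div (Num.sqrt h ^+ 2 * pi *+ 2)) ?mulrn_wge0 ?mulr_ge0 ?sqr_ge0 ?pi_ge0//.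
  by congr (Num.sqrt _); rewrite exprMn exprVn; field; rewrite gt_eqF.
rewrite exprMn exprVn sqr_sqrtr ?(ltW h0)//.
have sp0 : Num.sqrt (h * pi *+ 2) != 0.
  by rewrite gt_eqF// sqrtr_gt0 mulrn_wgt0// mulr_gt0// pi_gt0.
rewrite invf_div mulrCA -expRD.
rewrite [RHS](_ : _ = (Num.sqrt (h * pi *+ 2))^-1 * (expR (th ^+ 2 * h / (2 * u ^+ 2)) *
   expR (- (g - th * h / u ^+ 2) ^+ 2 / (h / u ^+ 2 *+ 2)))); last first.
  by field; rewrite sp0 gt_eqF.
rewrite -expRD; congr (_ * expR _).
by rewrite subr0; field; rewrite !gt_eqF.
Qed.

Lemma normal_integral_expR (h u th : R) : 0 < h -> 0 < u ->
  (\int[normal_prob 0%R (Num.sqrt h)]_g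
    (expR (th * g + (1 - u ^+ 2) / (2 * h) * g ^+ 2))%:E =
  (u^-1 * expR (th ^+ 2 * h / (2 * u ^+ 2)))%:E)%E.
Proof.
move=> h0 u0; rewrite normal_integral//; last first.
  apply/measurable_EFinP; apply: measurableT_comp => //.
  apply: measurable_funD; apply: measurable_funM => //.
under eq_integral do rewrite -EFinM normal_pdf_tilt// EFinM.
rewrite ge0_integralZl//.
- by rewrite integral_normal_pdf mule1.
- by apply/measurable_EFinP; exact: measurable_normal_pdf.
- by move=> x _; rewrite lee_fin normal_pdf_ge0.
- by rewrite lee_fin mulr_ge0 ?expR_ge0 ?invr_ge0 ?ltW.
Qed.

End GaussianIntegral.

Section IndependentIntegral.
Local Open Scope ereal_scope.
Context d d1 d2 (T : measurableType d) (T1 : measurableType d1)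
  (T2 : measurableType d2) (R : realType).
Variables (P : probability T R) (nu : probability T2 R).
Variables (U : T -> T1) (V : T -> T2).
Hypotheses (mU : measurable_fun setT U) (mV : measurable_fun setT V).
Hypothesis UV : forall A B, measurable A -> measurable B ->
  P (U @^-1` A `&` V @^-1` B) = P (U @^-1` A) * nu B.

Let mUV : measurable_fun setT (fun w => (U w, V w)).
Proof. exact: measurable_fun_pair. Qed.

Let U_pack : {mfun T >-> T1} := HB.pack U (isMeasurableFun.Build _ _ _ _ _ mU).
Let UV_pack : {mfun T >-> (T1 * T2)%type} :=
  HB.pack (fun w => (U w, V w)) (isMeasurableFun.Build _ _ _ _ _ mUV).

Lemma joint_distribution (A : set (T1 * T2)) : measurable A ->
  distribution P UV_pack A = (distribution P U_pack \x nu) A.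
Proof.
by move=> mA; apply/esym; exact: product_measure_unique.
Qed.

(** The hypothesis on rectangles makes the joint law of [U] and [V] a product measure, so this is
    Tonelli; it replaces conditioning on [U]. *)
Lemma ge0_integral_independent (f : T1 * T2 -> \bar R) :
  measurable_fun setT f -> (forall x, 0 <= f x) ->
  \int[P]_w f (U w, V w) = \int[P]_w \int[nu]_v f (U w, v).
Proof.
move=> mf f0.
transitivity (\int[distribution P UV_pack]_z f z).
  by rewrite ge0_integral_pushforward.
rewrite (eq_measure_integral (distribution P U_pack \x nu)%E); last first.
  by move=> A mA _; exact: joint_distribution.
rewrite fubini_tonelli1// ge0_integral_pushforward//.
  exact: (measurable_fun_fubini_tonelli_F f).
by move=> x _; exact: integral_ge0.
Qed.

Lemma integral_independent (f : T1 * T2 -> \bar R) :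
  measurable_fun setT f -> P.-integrable setT (fun w => f (U w, V w)) ->
  \int[P]_w f (U w, V w) = \int[P]_w \int[nu]_v f (U w, v).
Proof.
move=> mf fi.
transitivity (\int[distribution P UV_pack]_z f z).
  by rewrite integral_pushforward.
rewrite (eq_measure_integral (distribution P U_pack \x nu)%E); last first.
  by move=> A mA _; exact: joint_distribution.
have fi' : (distribution P U_pack \x nu)%E.-integrable setT f.
  apply/integrable12ltyP => //.
  have mf' : measurable_fun setT (fun z => `|f z|) by exact: measurableT_comp.
  rewrite ge0_integral_pushforward//; last 2 first.
  - exact: (measurable_fun_fubini_tonelli_F (fun z => `|f z|)).
  - by move=> x _; exact: integral_ge0.
  have <- := ge0_integral_independent mf' (fun x => abse_ge0 (f x)).
  by move/integrableP : fi => [].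
rewrite -integral12_prod_meas1// integral_pushforward//.
- exact: measurable_fubini_F fi'.
- rewrite /=.
  have := integrable_fubini_F fi'.
  move=> /integrableP[mF iF]; apply/integrableP; split.
    exact: measurableT_comp.
  by move: iF; rewrite ge0_integral_pushforward//; exact: measurableT_comp.
Qed.

End IndependentIntegral.

Section IndependentProduct.
Local Open Scope ereal_scope.
Context d (T : measurableType d) (R : realType).
Variables (P : probability T R) (nu : probability (measurableTypeR R) R).
Variables (U V : T -> R).
Hypotheses (mU : measurable_fun setT U) (mV : measurable_fun setT V).
Hypothesis UV : forall A B, measurable A -> measurable B ->
  P (U @^-1` A `&` V @^-1` B) = P (U @^-1` A) * nu B.

Lemma independent_integrableM (f : R -> R) : measurable_fun setT f ->
  P.-integrable setT (EFin \o U) -> nu.-integrable setT (EFin \o f) ->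
  P.-integrable setT (fun w => (U w * f (V w))%:E) /\
  \int[P]_w (U w * f (V w))%:E = \int[P]_w (U w)%:E * \int[nu]_v (f v)%:E.
Proof.
move=> mf iU iV.
pose g (z : R * R) := (z.1 * f z.2)%:E.
have mg : measurable_fun setT g.
  apply/measurable_EFinP; apply: measurable_funM => //.
  exact: measurableT_comp.
have ig : P.-integrable setT (fun w => g (U w, V w)).
  apply/integrableP; split.
    apply: measurableT_comp => //; exact: measurable_fun_pair.
  rewrite (@ge0_integral_independent _ _ _ _ _ _ _ P nu U V mU mV UV (fun z => `|g z|))//; last first.
    exact: measurableT_comp.
  rewrite /g/=; under eq_integral => w _.
    under eq_integral do rewrite normrM EFinM.
    rewrite ge0_integralZl//; last first.
      by apply/measurable_EFinP; exact: measurableT_comp.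
    over.
  rewrite ge0_integralZr//.
  - apply: lte_mul_pinfty => //; first exact: integral_ge0.
    rewrite ge0_fin_numE; last exact: integral_ge0.
    by move/integrableP : iU => [].
    by move/integrableP : iV => [].
  - by apply/measurable_EFinP; exact: measurableT_comp.
  - exact: integral_ge0.
split; first exact: ig.
rewrite (integral_independent (nu := nu) mU mV UV mg ig)/g/=.
under eq_integral do under eq_integral do rewrite EFinM.
under eq_integral do rewrite integralZl//.
have /fineK <- : \int[nu]_v (f v)%:E \is a fin_num by exact: integrable_fin_num.
by rewrite integralZr.
Qed.

End IndependentProduct.

(** The factor 1 - u changes sign at 1, so the hypothesis says m u (1 + u) <= 2h for u < 1 and the
    reverse for u > 1; both are pressed at u close to 1. *)
Lemma eq_of_second_moment_bounds (R : realType) (m h : R) : 0 < h -> 0 <= m ->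
  (forall u, 0 < u -> (1 - u) * (m * (u * (1 + u))) <= (1 - u) * (2 * h)) ->
  m = h.
Proof.
move=> h0 m_ge0 key.
apply/eqP; rewrite eq_le; apply/andP; split.
- rewrite leNgt; apply/negP => hm; have m0 := lt_trans h0 hm.
  (* For u = 1 - e, m u (1 + u) = 2m - 3 m e + m e^2; this [e] makes the linear loss m - h, half of
     the gap 2m - 2h. *)
  pose e := (m - h) / (3 * m).
  have m3 : 0 < 3 * m by rewrite mulr_gt0.
  have e0 : 0 < e by rewrite divr_gt0// subr_gt0.
  have eE : 3 * m * e = m - h by rewrite /e mulrC divfK// gt_eqF.
  have e1 : e < 1 by rewrite /e ltr_pdivrMr//; lra.
  have u0 : 0 < 1 - e by rewrite subr_gt0.
  have := key (1 - e) u0; rewrite subKr ler_pM2l//.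
  have : 0 < m * e ^+ 2 by rewrite mulr_gt0// exprn_gt0.
  nra.
- rewrite leNgt; apply/negP => hm.
  (* For u = 1 + e the gain is 3 m e + m e^2 <= 4 m e, which stays within h - m. *)
  pose e := (h - m) / (4 * h).
  have h4 : 0 < 4 * h by rewrite mulr_gt0.
  have e0 : 0 < e by rewrite divr_gt0// subr_gt0.
  have eE : 4 * h * e = h - m by rewrite /e mulrC divfK// gt_eqF.
  have e1 : e < 1 by rewrite /e ltr_pdivrMr//; lra.
  have u0 : 0 < 1 + e by lra.
  have := key (1 + e) u0; rewrite opprD addrA subrr sub0r !mulNr lerN2 ler_pM2l//.
  have : m * e ^+ 2 <= m * e by rewrite ler_wpM2l// expr2 ler_piMl// ltW.
  have : m * e <= h * e by rewrite ler_pM2r// ltW.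
  lra.
Qed.

(** The left side has a term of first order in [th], the right side exceeds 1 only by second order,
    so a small [th] of either sign excludes m <> 0. *)
Lemma eq0_of_mgf_bound (R : realType) (m h : R) : 0 < h ->
  (forall th, th * m + 1 <= expR (th ^+ 2 * h / 2)) -> m = 0.
Proof.
move=> h0 hm.
have key th : th ^+ 2 * h <= 1 -> th * m <= th ^+ 2 * h.
  move=> th1; have H := hm th.
  move: th1 H; have [y yE] : exists y, y = th ^+ 2 * h by eexists.
  rewrite -yE => th1 H.
  have y0 : 0 <= y by rewrite yE mulr_ge0 ?sqr_ge0 ?ltW.
  (* This gives exp(y/2) <= 1 / (1 - y/2), which is at most 1 + y for 0 <= y <= 1. *)
  have := expR_ge1Dx (- (y / 2)); rewrite expRN => H'.
  have e0 := expR_gt0 (y / 2).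
  have : (1 + - (y / 2)) * expR (y / 2) <= 1.
    by rewrite -ler_pdivlMr// div1r.
  nra.
have key2 th : 0 < th -> th ^+ 2 * h <= 1 -> `|m| <= th * h.
  move=> th0 th1; rewrite ler_norml; apply/andP; split.
    have := key (- th); rewrite sqrrN => /(_ th1).
    by rewrite expr2 -mulrA mulNr lerNl -mulrN ler_pM2l// lerNl.
  by have := key th th1; rewrite expr2 -mulrA ler_pM2l.
apply/eqP; rewrite -normr_le0 leNgt; apply/negP => m0.
(* Small enough for both th^2 h <= 1 and th h < |m|. *)
pose th := `|m| / ((1 + h) * (1 + `|m|)).
have D0 : 0 < (1 + h) * (1 + `|m|) by rewrite mulr_gt0// addr_gt0.
have th0 : 0 < th by rewrite divr_gt0.
have thE : th * ((1 + h) * (1 + `|m|)) = `|m| by rewrite divfK// gt_eqF.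
have th1 : th * (1 + h) <= 1.
  by rewrite -(ler_pM2r (_ : 0 < 1 + `|m|)) ?addr_gt0// -mulrA thE mul1r lerDr.
have th1' : th <= 1 by nra.
have := key2 th th0; have : th ^+ 2 * h <= 1 by nra.
move=> -> /(_ isT); apply/negP; rewrite -ltNge -[ltRHS]thE.
nra.
Qed.

Section GaussianMoments.
Context {R : realType}.
Variable h : R.
Hypothesis h0 : 0 < h.
Local Notation N := (normal_prob 0 (Num.sqrt h) : probability _ R).

Lemma normal_sqr_integrable : N.-integrable setT (fun g => (g ^+ 2)%:E).
Proof.
apply/integrableP; split.
  by apply/measurable_EFinP; exact: measurable_funX.
(* The choice u = 1/2 gives a positive coefficient for which exp(c g^2) is still integrable; it
   dominates c g^2. *)
pose c : R := (1 - (2^-1) ^+ 2) / (2 * h).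
have c0 : 0 < c by rewrite /c divr_gt0//; [lra|rewrite mulr_gt0].
apply: (@le_lt_trans _ _ (\int[N]_g (c^-1%:E * (expR (0 * g + c * g ^+ 2))%:E))%E).
  apply: ge0_le_integral => //.
  - apply: measurableT_comp => //; apply/measurable_EFinP; exact: measurable_funX.
  - apply/measurable_EFinP; apply: measurable_funM => //.
    apply: measurableT_comp => //; apply: measurable_funD; apply: measurable_funM => //.
  - move=> g _; rewrite /= -EFinM lee_fin ger0_norm ?sqr_ge0// ler_pdivlMl// mul0r add0r.
    by apply: le_trans (expR_ge1Dx _); rewrite lerDr.
rewrite ge0_integralZl//; last 2 first.
  - apply/measurable_EFinP; apply: measurableT_comp => //.
    by apply: measurable_funD; apply: measurable_funM.
  - by rewrite lee_fin invr_ge0 ltW.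
by rewrite normal_integral_expR// -EFinM ltry.
Qed.

Lemma normal_id_integrable : N.-integrable setT (fun g => g%:E).
Proof.
have i1 := integrableD measurableT (finite_measure_integrable_cst N 1 measurableT) normal_sqr_integrable.
apply: le_integrable i1 => //.
  exact/measurable_EFinP.
move=> g _; rewrite [leRHS](_ : _ = `|(1 + g ^+ 2)%:E|%E)// lee_fin [leRHS]ger0_norm; last by rewrite addr_ge0 ?sqr_ge0.
rewrite ler_norml; nra.
Qed.

Lemma normal_exp_integrable u th : 0 < u ->
  N.-integrable setT (fun g =>
    (expR (th * g + (1 - u ^+ 2) / (2 * h) * g ^+ 2))%:E).
Proof.
move=> u0; apply/integrableP; split.
  apply/measurable_EFinP; apply: measurableT_comp => //.
  by apply: measurable_funD; apply: measurable_funM.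
under eq_integral do rewrite gee0_abs ?lee_fin ?expR_ge0//.
by rewrite normal_integral_expR// ltry.
Qed.

(* Both signs of 1 - u^2 give bounds, from c g^2 + 1 <= exp (c g^2). *)
Lemma normal_sqr_le u : 0 < u ->
  (1 - u ^+ 2) / (2 * h) * fine (\int[N]_g (g ^+ 2)%:E) + 1 <= u^-1.
Proof.
move=> u0; set c := (1 - u ^+ 2) / (2 * h); set I := (\int[N]_g _)%E.
have If : I \is a fin_num by exact: (integrable_fin_num measurableT normal_sqr_integrable).
have : (\int[N]_g ((c * g ^+ 2)%:E + 1) <=
    (u^-1 * expR (0 ^+ 2 * h / (2 * u ^+ 2)))%:E)%E.
  rewrite -normal_integral_expR//; apply: le_integral => //.
  - apply: integrableD => //; last exact: (finite_measure_integrable_cst N 1).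
    under eq_fun do rewrite EFinM.
    by apply: integrableZl => //; exact: normal_sqr_integrable.
  - exact: normal_exp_integrable.
  - by move=> g _; rewrite -EFinD lee_fin mul0r add0r addrC expR_ge1Dx.
rewrite integralD//; last 2 first.
- under eq_fun do rewrite EFinM.
  by apply: integrableZl => //; exact: normal_sqr_integrable.
- exact: (finite_measure_integrable_cst N 1).
under eq_integral do rewrite EFinM.
rewrite integralZl//; last exact: normal_sqr_integrable.
rewrite integral_cst// [X in (1 * X)%E](probability_setT N) mul1e -/I -(fineK If).
by rewrite -EFinM -EFinD lee_fin expr0n/= !mul0r expR0 mulr1.
Qed.

Lemma normal_sqr_integral : (\int[N]_g (g ^+ 2)%:E = h%:E)%E.
Proof.
set I := (\int[N]_g _)%E.
have If : I \is a fin_num by exact: (integrable_fin_num measurableT normal_sqr_integrable).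
rewrite -(fineK If); congr EFin; apply: eq_of_second_moment_bounds => // [|u u0].
  by apply: fine_ge0; apply: integral_ge0 => g _; rewrite lee_fin sqr_ge0.
have := normal_sqr_le u0; rewrite -/I; move: (fine I) => m H.
have h2 : 0 < 2 * h by rewrite mulr_gt0.
have : ((1 - u ^+ 2) / (2 * h) * m + 1) * (u * (2 * h)) <= u^-1 * (u * (2 * h)).
  by rewrite ler_pM2r// mulr_gt0.
rewrite [X in X <= _](_ : _ = (1 - u ^+ 2) * m * u + u * (2 * h)); last first.
  by field; rewrite gt_eqF.
rewrite [X in _ <= X](_ : _ = 2 * h); last by field; rewrite gt_eqF.
by move=> H'; lra.
Qed.

Lemma normal_mean_le th :
  th * fine (\int[N]_g g%:E)%E + 1 <= expR (th ^+ 2 * h / 2).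
Proof.
set I := (\int[N]_g _)%E.
have If : I \is a fin_num by exact: (integrable_fin_num measurableT normal_id_integrable).
have : (\int[N]_g ((th * g)%:E + 1) <= (1^-1 * expR (th ^+ 2 * h / (2 * 1 ^+ 2)))%:E)%E.
  rewrite -normal_integral_expR//; apply: le_integral => //.
  - apply: integrableD => //; last exact: (finite_measure_integrable_cst N 1).
    under eq_fun do rewrite EFinM.
    by apply: integrableZl => //; exact: normal_id_integrable.
  - exact: normal_exp_integrable.
  - by move=> g _; rewrite -EFinD lee_fin expr1n subrr mul0r mul0r addr0 addrC expR_ge1Dx.
rewrite integralD//; last 2 first.
- under eq_fun do rewrite EFinM.
  by apply: integrableZl => //; exact: normal_id_integrable.
- exact: (finite_measure_integrable_cst N 1).
under eq_integral do rewrite EFinM.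
rewrite integralZl//; last exact: normal_id_integrable.
rewrite integral_cst// [X in (1 * X)%E](probability_setT N) mul1e -/I -[X in (_ * X + _)%E](fineK If).
by rewrite -EFinM -EFinD lee_fin invr1 mul1r expr1n mulr1.
Qed.

Lemma normal_mean : (\int[N]_g g%:E = 0)%E.
Proof.
have If : (\int[N]_g g%:E)%E \is a fin_num.
  exact: (integrable_fin_num measurableT normal_id_integrable).
rewrite -(fineK If); congr EFin; apply: (eq0_of_mgf_bound h0).
exact: normal_mean_le.
Qed.

End GaussianMoments.

Lemma measurable_fun_sub_sigma d (T : measurableType d) d' (T' : measurableType d')
    (G : set (set T)) (f : T -> T') : G `<=` measurable ->
  measurable_fun [set: g_sigma_algebraType G] f -> measurable_fun [set: T] f.
Proof.
move=> mG mf _ B mB.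
have sG : <<s G >> `<=` measurable.
  by apply: smallest_sub => //; exact: (@sigma_algebra_measurable _ T).
exact: sG (mf measurableT B mB).
Qed.

(** * Integrating out a Gaussian increment independent of the past *)

Section GaussianIncrement.
Context {R : realType} {d : measure_display} {T : measurableType d}.
Variable P : probability T R.

Definition gaussian_innovation (G : set (set T)) (V : T -> R) (h : R) : Prop :=
  [/\ measurable_fun setT V,
      independent_classes P <<s G >> (preimage_set_system setT V measurable) &
      forall B, measurable B -> P (V @^-1` B) = normal_prob 0 (Num.sqrt h) B].

Variables (G : set (set T)) (V : T -> R) (h : R).
Hypotheses (h0 : 0 < h) (mG : G `<=` measurable) (hV : gaussian_innovation G V h).
Local Notation N := (normal_prob 0 (Num.sqrt h) : probability _ R).

Let mV : measurable_fun setT V. Proof. by case: hV. Qed.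

Let indep d' (T' : measurableType d') (U : T -> T') A B :
  measurable_fun [set: g_sigma_algebraType G] U -> measurable A -> measurable B ->
  P (U @^-1` A `&` V @^-1` B) = (P (U @^-1` A) * N B)%E.
Proof.
move=> mU mA mB; case: hV => _ GV lawV.
have -> : N B = P (V @^-1` B) by exact/esym/lawV.
apply: GV; last by exists B => //; rewrite setTI.
by rewrite -[X in <<s G >> X]setTI; exact: mU.
Qed.

(** The coefficients [al] and [th] are known from [G], so they are frozen as one pair while [V] is
    integrated. The integrands are nonnegative, so both sides may be infinite. *)
Lemma gaussian_innovation_expR (al th : T -> R) (u : R) : 0 < u ->
  measurable_fun [set: g_sigma_algebraType G] al ->
  measurable_fun [set: g_sigma_algebraType G] th ->
  (\int[P]_w (expR (al w + (th w * V w + (1 - u ^+ 2) / (2 * h) * V w ^+ 2)))%:E =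
   \int[P]_w (u^-1 * expR (al w + th w ^+ 2 * h / (2 * u ^+ 2)))%:E)%E.
Proof.
move=> u0 mal mth.
have mU : measurable_fun [set: g_sigma_algebraType G] (fun w => (al w, th w)).
  exact: measurable_fun_pair.
pose f (z : (R * R) * R) := (expR (z.1.1 + (z.1.2 * z.2 +
  (1 - u ^+ 2) / (2 * h) * z.2 ^+ 2)))%:E.
have mf : measurable_fun setT f.
  apply/measurable_EFinP; apply: measurableT_comp => //.
  apply: measurable_funD; first by do 2! apply: measurableT_comp => //.
  apply: measurable_funD; apply: measurable_funM => //.
  by do 2! apply: measurableT_comp => //.
  by apply: measurable_funX.
rewrite (ge0_integral_independent (nu := N) (measurable_fun_sub_sigma mG mU) mV
  (fun A B => indep mU) mf)//; last by move=> z; rewrite lee_fin expR_ge0.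
apply: eq_integral => w _; rewrite /f/=.
under eq_integral do rewrite expRD EFinM.
rewrite ge0_integralZl//; last first.
  apply/measurable_EFinP; apply: measurableT_comp => //.
  by apply: measurable_funD; apply: measurable_funM.
by rewrite normal_integral_expR// -EFinM mulrCA -expRD.
Qed.

Lemma gaussian_innovation_mean (z : T -> R) :
  measurable_fun [set: g_sigma_algebraType G] z ->
  P.-integrable setT (EFin \o z) ->
  P.-integrable setT (fun w => (z w * V w)%:E) /\
  (\int[P]_w (z w * V w)%:E = 0)%E.
Proof.
move=> mz iz.
have [] := independent_integrableM (nu := N) (measurable_fun_sub_sigma mG mz) mV
  (fun A B => indep mz) (@measurable_id _ _ _) iz (normal_id_integrable h0).
by move=> ? ->; split => //; rewrite normal_mean// mule0.
Qed.

Lemma gaussian_innovation_sqr (z : T -> R) :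
  measurable_fun [set: g_sigma_algebraType G] z ->
  P.-integrable setT (EFin \o z) ->
  P.-integrable setT (fun w => (z w * V w ^+ 2)%:E) /\
  (\int[P]_w (z w * V w ^+ 2)%:E = h%:E * \int[P]_w (z w)%:E)%E.
Proof.
move=> mz iz.
have [] := independent_integrableM (nu := N) (measurable_fun_sub_sigma mG mz) mV
  (fun A B => indep mz) (measurable_funX 2 (@measurable_id _ _ _))
  iz (normal_sqr_integrable h0).
by move=> ? ->; split => //; rewrite normal_sqr_integral// muleC.
Qed.

End GaussianIncrement.

Section PlanarInnovation.
Context {R : realType} {d : measure_display} {T : measurableType d}.
Variables (P : probability T R) (X Y : R -> {RV P >-> R}).
Hypothesis hB : brownian_motion2 X Y.

Lemma filtration_generator_measurable a b :
  filtration_generator X Y a b `<=` measurable.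
Proof. by move=> A [|]; exact: sigma_process_measurable. Qed.

Lemma innovationY a b u : 0 <= a <= 1 -> 0 <= b -> b < u -> u <= 1 ->
  gaussian_innovation P (filtration_generator X Y a b) (increment Y b u) (u - b).
Proof.
move=> a01 b0 bu u1; split.
- exact: measurable_increment.
- by apply: filtration_independent => //; exact: ltW.
- by case: hB => _ [_ _ lawY _] _ B mB; exact: lawY.
Qed.

Lemma measurable_filtrationX a b r : 0 <= r <= a ->
  measurable_fun [set: g_sigma_algebraType (filtration_generator X Y a b)] (X r).
Proof.
move=> ra _ V mV; apply: sub_sigma_algebra; left.
by apply: measurable_fun_sigma_process; rewrite //= in_itv.
Qed.

Lemma measurable_filtrationY a b r : 0 <= r <= b ->
  measurable_fun [set: g_sigma_algebraType (filtration_generator X Y a b)] (Y r).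
Proof.
move=> ra _ V mV; apply: sub_sigma_algebra; right.
by apply: measurable_fun_sigma_process; rewrite //= in_itv.
Qed.

Lemma sub_filtration_generator a b a' b' : a <= a' -> b <= b' ->
  <<s filtration_generator X Y a b >> `<=` <<s filtration_generator X Y a' b' >>.
Proof.
move=> aa bb; have sub (c c' : R) : c <= c' -> `[0, c] `<=` `[0, c'].
  by move=> cc r /=; rewrite !in_itv/= => /andP[-> rc]; exact: le_trans cc.
apply: smallest_sub; first exact: smallest_sigma_algebra.
move=> A [XA|YA]; apply: sub_sigma_algebra; [left|right].
  exact: sub_sigma_process (sub _ _ aa) _ XA.
exact: sub_sigma_process (sub _ _ bb) _ YA.
Qed.

Lemma measurable_filtrationS a b a' b' (f : T -> R) : a <= a' -> b <= b' ->
  measurable_fun [set: g_sigma_algebraType (filtration_generator X Y a b)] f ->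
  measurable_fun [set: g_sigma_algebraType (filtration_generator X Y a' b')] f.
Proof.
by move=> aa bb mf _ V mV; apply: (sub_filtration_generator aa bb); exact: mf.
Qed.

End PlanarInnovation.

(** * The discrete area *)

Section DiscreteArea.
Context {R : realType} {d : measure_display} {T : measurableType d}.
Variable P : probability T R.
Implicit Types X Y : R -> {RV P >-> R}.

Definition ito_sum X Y (h : R) (k : nat) (w : T) : R :=
  \sum_(i < k) X (i%:R * h) w * increment Y (i%:R * h) (i.+1%:R * h) w.

(** Left-endpoint sums do give the area of the polygonal path: passing to midpoints would add half
    the product of the two increments to both sums, which cancels in the difference. *)
Definition discrete_area X Y (h : R) (k : nat) (w : T) : R :=
  2^-1 * (ito_sum X Y h k w - ito_sum Y X h k w).

Lemma ito_sum_measurable X Y h k a b : 0 <= h -> k%:R * h <= a -> k%:R * h <= b ->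
  measurable_fun [set: g_sigma_algebraType (filtration_generator X Y a b)]
    (ito_sum X Y h k).
Proof.
move=> h0 ka kb; apply: measurable_sum => i.
have ik : i.+1%:R * h <= k%:R * h by rewrite ler_wpM2r// ler_nat.
have ii : i%:R * h <= i.+1%:R * h by rewrite ler_wpM2r// ler_nat.
have i0 : 0 <= i%:R * h by rewrite mulr_ge0.
apply: measurable_funM.
  by apply: measurable_filtrationX; rewrite i0/= (le_trans ii)// (le_trans ik).
apply: measurable_funB; apply: measurable_filtrationY.
  by rewrite (le_trans i0)//= (le_trans ik).
by rewrite i0/= (le_trans ii)// (le_trans ik).
Qed.

Lemma discrete_area_measurable X Y h k a b :
  0 <= h -> k%:R * h <= a -> k%:R * h <= b ->
  measurable_fun [set: g_sigma_algebraType (filtration_generator X Y a b)]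
    (discrete_area X Y h k).
Proof.
move=> h0 ka kb; apply: measurable_funM => //; apply: measurable_funB.
  exact: ito_sum_measurable.
by rewrite filtration_generatorC; exact: ito_sum_measurable.
Qed.

(* First the increment of Y is integrated out, then that of X; the cross terms
   in x y cancel. *)
Lemma discrete_area_step X Y (h z c : R) k : brownian_motion2 X Y ->
  0 < h -> k.+1%:R * h <= 1 -> 0 < 1 - 2 * c * h ->
  let x := X (k%:R * h) in let y := Y (k%:R * h) in
  let x' := X (k.+1%:R * h) in let y' := Y (k.+1%:R * h) in
  (\int[P]_w (expR (z * discrete_area X Y h k.+1 w + c * (x' w ^+ 2 + y' w ^+ 2)))%:E =
   \int[P]_w ((1 - 2 * c * h)^-1 * expR (z * discrete_area X Y h k w +
     (c + z ^+ 2 * h / 8) / (1 - 2 * c * h) * (x w ^+ 2 + y w ^+ 2)))%:E)%E.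
Proof.
move=> hB h0 k1 ch x y x' y'.
have hB' := brownian_motion2C hB.
set t := k%:R * h; set t' := k.+1%:R * h.
have t0 : 0 <= t by rewrite mulr_ge0// ltW.
have tt' : t < t' by rewrite ltr_pM2r// ltr_nat.
have tt'_le := ltW tt'.
have t'0 : 0 <= t' := le_trans t0 tt'_le.
have htt' : t' - t = h by rewrite /t' /t -mulrBl -natrB// subSnn mul1r.
pose u := Num.sqrt (1 - 2 * c * h).
have u0 : 0 < u by rewrite sqrtr_gt0.
have u2 : u ^+ 2 = 1 - 2 * c * h by rewrite sqr_sqrtr ?ltW.
have cE : (1 - u ^+ 2) / (2 * h) = c by rewrite u2; field; rewrite gt_eqF.
pose dx := increment X t t'; pose dy := increment Y t t'.
pose a := discrete_area X Y h k.
(* [th] and [th2] are the coefficients of [dy] and [dx] in the exponent; [al] and [al2] collect what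
   is known before the respective integration. *)
pose th w := z * x w / 2 + 2 * c * y w.
pose al w := z * (a w - y w * dx w / 2) + c * (x' w ^+ 2 + y w ^+ 2).
pose th2 w := - (z * y w) / 2 + 2 * c * x w.
pose al2 w := z * a w + c * (x w ^+ 2 + y w ^+ 2) + th w ^+ 2 * h / (2 * u ^+ 2).
have mx s : 0 <= s -> t <= s -> measurable_fun [set: g_sigma_algebraType
    (filtration_generator X Y s t)] x.
  by move=> s0 ts; apply: measurable_filtrationX; rewrite t0.
have my s : measurable_fun [set: g_sigma_algebraType
    (filtration_generator X Y s t)] y.
  by apply: measurable_filtrationY; rewrite t0/=.
have ma s : t <= s -> measurable_fun [set: g_sigma_algebraType
    (filtration_generator X Y s t)] a.
  by move=> ts; apply: discrete_area_measurable => //; exact: ltW.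
transitivity (\int[P]_w (expR (al w + (th w * dy w +
    (1 - u ^+ 2) / (2 * h) * dy w ^+ 2)))%:E)%E.
  apply: eq_integral => w _; congr (expR _)%:E.
  rewrite cE /discrete_area /ito_sum !big_ord_recr/= -/t -/t'.
  rewrite /al /th /a /discrete_area /ito_sum /dx /dy /increment /x' /y' /x /y -/t -/t'.
  by field.
(* X is known up to [t'] here because [al] still contains [dx]. *)
have iY : gaussian_innovation P (filtration_generator X Y t' t) dy h.
  by rewrite -htt'; apply: innovationY => //; rewrite k1 (le_trans t0)// ltW.
have mth s : 0 <= s -> t <= s -> measurable_fun [set: g_sigma_algebraType
    (filtration_generator X Y s t)] th.
  move=> s0 ts; apply: measurable_funD; apply: measurable_funM => //.
  by apply: measurable_funM => //; exact: mx.
rewrite (gaussian_innovation_expR h0 (@filtration_generator_measurable _ _ _ _ _ _ _ _) iY u0); last 2 first.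
- apply: measurable_funD; apply: measurable_funM => //.
    apply: measurable_funB; first exact: ma.
    apply: measurable_funM => //; apply: measurable_funM => //.
    by apply: measurable_funB; apply: measurable_filtrationX;
      rewrite ?t0 ?t'0 ?lexx.
  apply: measurable_funD; apply: measurable_funX => //.
  by apply: measurable_filtrationX; rewrite lexx t'0.
- exact: mth.
have iX : gaussian_innovation P (filtration_generator Y X t t) dx h.
  rewrite -htt'; apply: innovationY => //; rewrite t0/=.
  exact: le_trans (ltW tt') k1.
have mth2 : measurable_fun [set: g_sigma_algebraType
    (filtration_generator X Y t t)] th2.
  apply: measurable_funD; apply: measurable_funM => //; last exact: mx.
  by apply: measurableT_comp => //; apply: measurable_funM.
have mal2 : measurable_fun [set: g_sigma_algebraType
    (filtration_generator X Y t t)] al2.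
  apply: measurable_funD; last first.
    by do 2 apply: measurable_funM => //; apply: measurable_funX; exact: mth.
  apply: measurable_funD; apply: measurable_funM => //; first exact: ma.
  by apply: measurable_funD; apply: measurable_funX => //; exact: mx.
have H2 : (\int[P]_w (expR (al2 w + (th2 w * dx w +
    (1 - u ^+ 2) / (2 * h) * dx w ^+ 2)))%:E =
   \int[P]_w (u^-1 * expR (al2 w + th2 w ^+ 2 * h / (2 * u ^+ 2)))%:E)%E.
  apply: (gaussian_innovation_expR h0 (@filtration_generator_measurable _ _ _ _ _ _ _ _) iX u0).
    by rewrite filtration_generatorC.
  by rewrite filtration_generatorC.
have mT (f : T -> R) : measurable_fun [set: g_sigma_algebraType
    (filtration_generator X Y t t)] f -> measurable_fun setT f.
  exact: measurable_fun_sub_sigma (@filtration_generator_measurable _ _ _ _ _ _ _ _).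
have ui0 : 0 <= u^-1 by rewrite invr_ge0 ltW.
(* Expanding x' = x + dx inside [al] exposes the quadratic polynomial in [dx] for the second
   integration. *)
transitivity (u^-1%:E * \int[P]_w (expR (al2 w + (th2 w * dx w +
    (1 - u ^+ 2) / (2 * h) * dx w ^+ 2)))%:E)%E.
  rewrite -ge0_integralZl_EFin//; last first.
    apply/measurable_EFinP; apply: measurableT_comp => //.
    apply: measurable_funD; first exact: mT.
    apply: measurable_funD; apply: measurable_funM => //; first exact: mT.
    exact: measurable_increment.
    by apply: measurable_funX; exact: measurable_increment.
  apply: eq_integral => w _; rewrite -EFinM; congr (_ * expR _)%:E.
  by rewrite cE /al /al2 /th2 /dx /increment /x' /x -/t -/t'; field; rewrite gt_eqF.
rewrite H2 -ge0_integralZl_EFin//; last 2 first.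
- by move=> w _; rewrite lee_fin mulr_ge0 ?expR_ge0.
- apply/measurable_EFinP; apply: measurable_funM => //; apply: measurableT_comp => //.
  apply: measurable_funD; first exact: mT.
  by do 2 apply: measurable_funM => //; apply: measurable_funX; exact: mT.
(* The two factors 1/u give 1 / (1 - 2ch), and th^2 + th2^2 = (z^2/4 + 4c^2)(x^2 + y^2). *)
apply: eq_integral => w _; rewrite -EFinM mulrA; congr (_ * expR _)%:E.
  by rewrite -invfM -expr2 u2.
rewrite /al2 /th2 /th /a u2; field.
by rewrite gt_eqF.
Qed.

(* The ratio c = p / q satisfies c' = (c + z^2 h / 8) / (1 - 2 c h). *)
Fixpoint riccati (z h : R) (k : nat) : R * R :=
  if k is k'.+1 then
    let: (p, q) := riccati z h k' in (p + z ^+ 2 * h / 8 * q, q - 2 * h * p)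
  else (0, 1).

(** A joint induction: q <= 1 and z^2 <= 1 let p gain at most h/8 per step, and p <= 1/8 lets q lose
    at most h/4. *)
Lemma riccati_bounds (z h : R) k : `|z| <= 1 -> 0 <= h -> k%:R * h <= 1 ->
  [/\ 0 <= (riccati z h k).1, (riccati z h k).1 <= k%:R * h / 8,
      1 - k%:R * h / 4 <= (riccati z h k).2 & (riccati z h k).2 <= 1].
Proof.
move=> z1 h0; have z2 : z ^+ 2 <= 1 by rewrite -real_normK ?num_real// exprn_ile1.
have z20 := sqr_ge0 z.
elim: k => [_|k IH]; first by rewrite /= !mul0r subr0.
rewrite -natr1 mulrDl mul1r => kh1.
have kh0 : 0 <= k%:R * h by rewrite mulr_ge0.
have kh : k%:R * h <= 1 by lra.
have [] := IH kh; rewrite /=; case: (riccati z h k) => p q /= p0 p1 q1 q2.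
have zh0 : 0 <= z ^+ 2 * h by rewrite mulr_ge0.
have zh : z ^+ 2 * h <= h by rewrite ler_piMl.
have q0 : 0 <= q by lra.
have zhq0 : 0 <= z ^+ 2 * h * q by rewrite mulr_ge0.
have zhq : z ^+ 2 * h * q <= h by rewrite (le_trans _ zh)// ler_piMr.
have hp0 : 0 <= h * p by rewrite mulr_ge0.
have hp : h * p <= h / 8 by rewrite ler_wpM2l//; lra.
split; lra.
Qed.

Lemma riccati_gt0 (z h : R) k : `|z| <= 1 -> 0 <= h -> k%:R * h <= 1 ->
  3 / 4 <= (riccati z h k).2.
Proof. by move=> z1 h0 kh; have [] := riccati_bounds z1 h0 kh; lra. Qed.

(** The last [j] steps are integrated out backwards from the final time. Each contributes 1 / (1 -
    2ch), which is q / q' for consecutive denominators, so the product telescopes to 1/q. *)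
Lemma discrete_area_mgf_rec X Y (h z : R) k j : brownian_motion2 X Y ->
  `|z| <= 1 -> 0 < h -> (k + j)%:R * h <= 1 ->
  (\int[P]_w (expR (z * discrete_area X Y h (k + j) w))%:E =
   \int[P]_w ((riccati z h j).2^-1 * expR (z * discrete_area X Y h k w +
     (riccati z h j).1 / (riccati z h j).2 *
     (X (k%:R * h) w ^+ 2 + Y (k%:R * h) w ^+ 2)))%:E)%E.
Proof.
move=> hB z1 h0; have hle := ltW h0; elim: j k => [|j IH] k kh.
  rewrite addn0 /=; apply: eq_integral => w _.
  by rewrite invr1 mul1r mul0r mul0r addr0.
have kh' : j.+1%:R * h <= 1.
  by rewrite (le_trans _ kh)// ler_wpM2r// ler_nat leq_addl.
have kh'' : j%:R * h <= 1 by rewrite (le_trans _ kh')// ler_wpM2r// ler_nat.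
have k1h : k.+1%:R * h <= 1.
  by rewrite (le_trans _ kh)// ler_wpM2r// ler_nat addnS ltnS leq_addr.
rewrite -addSnnS IH ?addSnnS//.
have q0 := riccati_gt0 z1 (ltW h0) kh''.
have q'0 := riccati_gt0 z1 (ltW h0) kh'.
rewrite [in RHS]/=; move: q0 q'0; rewrite /=.
case: (riccati z h j) => p q /= q0 q'0.
have qp : 0 < q by lra.
have q'p : 0 < q - 2 * h * p by lra.
have qi0 : 0 <= q^-1 by rewrite invr_ge0 ltW.
have cE : 1 - 2 * (p / q) * h = (q - 2 * h * p) / q by field; rewrite gt_eqF.
have c0 : 0 < 1 - 2 * (p / q) * h by rewrite cE divr_gt0.
have mT m : m%:R * h <= 1 -> measurable_fun setT (discrete_area X Y h m).
  move=> mh; apply: (@measurable_fun_sub_sigma _ _ _ _ (filtration_generator X Y 1 1)).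
    exact: filtration_generator_measurable.
  by apply: discrete_area_measurable => //; exact: ltW.
have kh0 : k%:R * h <= 1 by rewrite (le_trans _ k1h)// ler_wpM2r// ler_nat.
have mE m c : m%:R * h <= 1 -> measurable_fun setT (fun w =>
    expR (z * discrete_area X Y h m w + c * (X (m%:R * h) w ^+ 2 + Y (m%:R * h) w ^+ 2))).
  move=> mh; apply: measurableT_comp => //; apply: measurable_funD.
    by apply: measurable_funM => //; exact: mT.
  by apply: measurable_funM => //; apply: measurable_funD; apply: measurable_funX.
under eq_integral do rewrite EFinM.
rewrite ge0_integralZl_EFin//; last first.
  by apply/measurable_EFinP; exact: mE.
rewrite (discrete_area_step _ hB h0 k1h c0) -ge0_integralZl_EFin//; last 2 first.
- by move=> w _; rewrite lee_fin mulr_ge0 ?expR_ge0// invr_ge0 ltW.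
- by apply/measurable_EFinP; apply: measurable_funM => //; exact: mE.
apply: eq_integral => w _; rewrite -EFinM [in LHS](mulrA q^-1); congr (_ * expR _)%:E.
  by rewrite cE; field; rewrite !gt_eqF.
by rewrite cE; field; rewrite !gt_eqF.
Qed.

Lemma discrete_area_mgf X Y (n : nat) (z : R) : brownian_motion2 X Y ->
  `|z| <= 1 ->
  (\int[P]_w (expR (z * discrete_area X Y n.+1%:R^-1 n.+1 w))%:E =
   ((riccati z n.+1%:R^-1 n.+1).2^-1)%:E)%E.
Proof.
move=> hB z1; set h := n.+1%:R^-1.
have h0 : 0 < h by rewrite invr_gt0 ltr0n.
have hn : (0 + n.+1)%:R * h <= 1 by rewrite add0n mulfV.
rewrite -[X in discrete_area _ _ _ X]add0n (discrete_area_mgf_rec hB z1 h0 hn).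
set q := (riccati z h n.+1).2; set p := (riccati z h n.+1).1.
have mq (c : R) : measurable_fun setT (fun w => (q^-1 * expR (z * discrete_area X Y h 0 w +
     c * (X (0%:R * h) w ^+ 2 + Y (0%:R * h) w ^+ 2)))%:E).
  apply/measurable_EFinP; apply: measurable_funM => //; apply: measurableT_comp => //.
  apply: measurable_funD; apply: measurable_funM => //.
    rewrite (_ : discrete_area X Y h 0 = cst 0)//; apply/funext => w.
    by rewrite /discrete_area /ito_sum !big_ord0 subr0 mulr0.
  by apply: measurable_funD; apply: measurable_funX.
rewrite (ae_eq_integral (fun=> (q^-1)%:E)) ?integral_cst//.
  by rewrite [X in (_ * X)%E]probability_setT mule1.
case: hB => [[X0 _ _ _] [Y0 _ _ _] _].
apply: filterS2 X0 Y0 => w x0 y0 _.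
by rewrite mul0r x0 y0 /discrete_area /ito_sum !big_ord0 subrr !mulr0 expr0n/= addr0
  mulr0 addr0 expR0 mulr1.
Qed.

End DiscreteArea.

(** * The limit of the discrete moment generating function *)

Section RiccatiLimit.
Context {R : realType}.
Implicit Types z h b : R.

(* Up to scaling, q + i p is (1 + i z h / 2)^k in polar form. *)
Lemma riccati_trigo z h k : let b := atan (z * h / 2) in
  riccati z h k = (z / 4 * (sin (k%:R * b) / cos b ^+ k), cos (k%:R * b) / cos b ^+ k).
Proof.
move=> b.
have c0 : 0 < cos b by apply: cos_gt0_pihalf; rewrite atan_gtNpi2 atan_ltpi2.
have sE : sin b = z * h / 2 * cos b.
  have : tan b = z * h / 2 by exact: atanK.
  by rewrite /tan => <-; rewrite divfK// gt_eqF.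
elim: k => [|k /= ->]; first by rewrite /= !mul0r sin0 cos0 expr0 mul0r mulr0 divr1.
have cN : cos b ^+ k != 0 by rewrite expf_neq0// gt_eqF.
have -> : k.+1%:R * b = k%:R * b + b by rewrite -natr1 mulrDl mul1r.
rewrite sinD cosD sE (exprSr (cos b)).
by congr (_, _); field; rewrite gt_eqF.
Qed.

Lemma bernoulli_ge (x : R) n : 0 <= x -> x <= 1 -> 1 - n%:R * x <= (1 - x) ^+ n.
Proof.
move=> x0 x1; elim: n => [|n IH]; first by rewrite mul0r subr0 expr0.
rewrite exprS; apply: (@le_trans _ _ ((1 - x) * (1 - n%:R * x))).
  rewrite -natr1; have : 0 <= n%:R * x * x by rewrite !mulr_ge0.
  nra.
by rewrite ler_wpM2l// subr_ge0.
Qed.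

(** This is the derivative 1 of [atan] at 0, taken along the steps z / (2N). The difference quotient
    needs a nonzero step, so z = 0 is separate. *)
Lemma cvg_scaled_atan z : n.+1%:R * atan (z * n.+1%:R^-1 / 2) @[n --> \oo] --> z / 2.
Proof.
have [->|z0] := eqVneq z 0.
  under eq_fun do rewrite mul0r mul0r atan0 mulr0.
  by rewrite mul0r; exact: cvg_cst.
have datan : h^-1 *: (atan (h *: 1 + 0) - atan (0 : R)) @[h --> 0^'] --> (1 : R).
  have [] := is_derive1_atan (0 : R); rewrite /derivable /derive.
  by rewrite expr0n/= addr0 invr1 => + dE; rewrite dE.
pose s n : R := z * n.+1%:R^-1 / 2.
have s0 : s n @[n --> \oo] --> (0 : R).
  rewrite -(mul0r (2^-1)) -[X in X / 2](mulr0 z); apply: cvgMr_tmp; apply: cvgMl_tmp.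
  exact: cvg_harmonic.
have sN0 n : s n != 0 by rewrite !mulf_neq0// invr_neq0// pnatr_eq0.
have s0' : s n @[n --> \oo] --> (0 : R)^'.
  move=> A A0.
  have H : \forall n \near \oo, s n != 0 -> A (s n).
    exact: (s0 _ (A0 : nbhs (0 : R) [set y | y != 0 -> A y])).
  have : \forall n \near \oo, A (s n).
    by apply: filterS H => n; apply; exact: sN0.
  by [].
have L : z / 2 * ((s n)^-1 * (atan (s n * 1 + 0) - atan 0)) @[n --> \oo] --> z / 2 * 1.
  by apply: cvgMl_tmp; exact: (cvg_comp _ _ s0' datan).
rewrite mulr1 in L.
suff -> : (fun n => n.+1%:R * atan (z * n.+1%:R^-1 / 2)) =
    (fun n => z / 2 * ((s n)^-1 * (atan (s n * 1 + 0) - atan 0))) by [].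
apply/funext => n; rewrite atan0 subr0 addr0 /s mulr1 mulrA; congr (_ * _).
by field; rewrite nat1r z0 pnatr_eq0.
Qed.

(** With a = z / (2N) = tan b one has cos b >= cos^2 b = 1 / (1 + a^2) >= 1 - a^2, and Bernoulli
    bounds the N-th power below by 1 - N a^2 = 1 - z^2 / (4N). *)
Lemma cvg_cos_expn z :
  cos (atan (z * n.+1%:R^-1 / 2)) ^+ n.+1 @[n --> \oo] --> (1 : R).
Proof.
have H : (1 - z ^+ 2 / 4 * n.+1%:R^-1 : R) @[n --> \oo] --> 1 - z ^+ 2 / 4 * 0.
  by apply: cvgB; [exact: cvg_cst|apply: cvgMl_tmp; exact: cvg_harmonic].
rewrite mulr0 subr0 in H.
suff B : \forall n \near \oo, 1 - z ^+ 2 / 4 * n.+1%:R^-1 <=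
    cos (atan (z * n.+1%:R^-1 / 2)) ^+ n.+1 <= 1.
  by apply: (squeeze_cvgr B H); exact: cvg_cst.
near=> n.
set a : R := z * n.+1%:R^-1 / 2; set b := atan a.
have c0 : 0 < cos b by apply: cos_gt0_pihalf; rewrite atan_gtNpi2 atan_ltpi2.
have c1 : cos b <= 1 := cos_le1 b.
rewrite exprn_ile1 ?(ltW c0)// andbT.
have n0 : 0 < n.+1%:R :> R by rewrite ltr0n.
have c2 : (1 + a ^+ 2) * cos b ^+ 2 = 1.
  have := cos2_tan2 (lt0r_neq0 c0); rewrite [tan _]atanK => <-.
  by rewrite mulVf// expf_neq0// gt_eqF.
have a2E : n.+1%:R * a ^+ 2 = z ^+ 2 / 4 * n.+1%:R^-1.
  by rewrite /a; field; rewrite nat1r pnatr_eq0.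
have ca : 1 - a ^+ 2 <= cos b.
  have := sqr_ge0 a; have := sqr_ge0 (a ^+ 2); nra.
have a1 : a ^+ 2 <= 1.
  have : 0 < 1 - z ^+ 2 / 4 * n.+1%:R^-1 by near: n; exact: (cvgr_gt 1 H).
  rewrite -a2E subr_gt0 => /ltW; apply: le_trans.
  by rewrite ler_peMl ?sqr_ge0// ler1n.
rewrite -a2E; apply: le_trans (bernoulli_ge _ _ _) _ => //; first exact: sqr_ge0.
by rewrite lerXn2r ?nnegrE ?subr_ge0// ltW.
Unshelve. all: end_near.
Qed.

Lemma cvg_riccati z :
  (riccati z n.+1%:R^-1 n.+1).2 @[n --> \oo] --> cos (z / 2).
Proof.
rewrite -[X in _ --> X]divr1.
under eq_fun do rewrite riccati_trigo/=.
apply: cvgM.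
  apply: continuous_cvg; first exact: continuous_cos.
  exact: cvg_scaled_atan.
apply: cvgV; first exact: oner_neq0.
exact: cvg_cos_expn.
Qed.

End RiccatiLimit.

(** * Ito isometry *)

Lemma integral_sum2_EFin d (T : measurableType d) (R : realType)
    (mu : {measure set T -> \bar R}) (D : set T) (I : finType)
    (f : I -> I -> T -> R) : measurable D ->
  (forall i j, mu.-integrable D (fun x => (f i j x)%:E)) ->
  (\int[mu]_(x in D) (\sum_i \sum_j f i j x)%:E =
   \sum_i \sum_j \int[mu]_(x in D) (f i j x)%:E)%E.
Proof.
move=> mD fi; under eq_integral do rewrite -sumEFin.
rewrite integral_sum//; last first.
  move=> i; under eq_fun do rewrite -sumEFin.
  by apply: integrable_sum => // j _; exact: fi.
apply: eq_bigr => i _; under eq_integral do rewrite -sumEFin.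
by rewrite integral_sum.
Qed.

Lemma setI_itv_oc (R : realType) (a b c e : R) :
  `]a, b] `&` `]c, e] = [set` `]Num.max a c, Num.min b e]%R] :> set R.
Proof.
apply/seteqP; split => s /=; rewrite !in_itv/= gt_max le_min.
  by move=> [/andP[-> ->] /andP[-> ->]].
by move=> /andP[/andP[-> ->] /andP[-> ->]].
Qed.

Section SquareIntegrable.
Context {R : realType} {d : measure_display} {T : measurableType d}.
Variable P : probability T R.
Implicit Types f g : T -> R.

Definition sq_integrable f :=
  measurable_fun setT f /\ P.-integrable setT (fun w => (f w ^+ 2)%:E).

Lemma sq_integrableM f g : sq_integrable f -> sq_integrable g ->
  P.-integrable setT (fun w => (f w * g w)%:E).
Proof.
move=> [mf if2] [mg ig2].
apply: le_integrable (integrableD measurableT if2 ig2) => //.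
  by apply/measurable_EFinP; exact: measurable_funM.
move=> w _; rewrite [leRHS](_ : _ = `|(f w ^+ 2 + g w ^+ 2)%:E|%E)// lee_fin.
rewrite [leRHS]ger0_norm ?addr_ge0 ?sqr_ge0//.
by rewrite ler_norml; apply/andP; split; nra.
Qed.

Lemma sq_integrableZ (c : R) f : sq_integrable f -> sq_integrable (fun w => c * f w).
Proof.
move=> [mf if2]; split; first exact: measurable_funM.
under eq_fun do rewrite exprMn EFinM.
exact: integrableZl.
Qed.

Lemma sq_integrableD f g : sq_integrable f -> sq_integrable g ->
  sq_integrable (fun w => f w + g w).
Proof.
move=> hf hg; have ifg := sq_integrableM hf hg.
move: hf hg => [mf if2] [mg ig2]; split; first exact: measurable_funD.
apply: le_integrable (integrableZl measurableT 2 (integrableD measurableT if2 ig2)) => //.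
  by apply/measurable_EFinP; apply: measurable_funX; exact: measurable_funD.
move=> w _; rewrite [leRHS](_ : _ = `|(2 * (f w ^+ 2 + g w ^+ 2))%:E|%E)// lee_fin.
rewrite ger0_norm ?sqr_ge0// ger0_norm; last by rewrite mulr_ge0 ?addr_ge0 ?sqr_ge0.
by have := sqr_ge0 (f w - g w); nra.
Qed.

Lemma sq_integrable_bounded f (M : R) : measurable_fun setT f ->
  (forall w, `|f w| <= M) -> sq_integrable f.
Proof.
move=> mf fM; split => //.
apply: le_integrable (finite_measure_integrable_cst P (M ^+ 2) measurableT) => //.
  by apply/measurable_EFinP; exact: measurable_funX.
move=> w _; rewrite /= lee_fin !normrX.
by rewrite lerXn2r ?nnegrE// (le_trans (fM w))// ler_norm.
Qed.

End SquareIntegrable.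

Section BrownianSquareIntegrable.
Context {R : realType} {d : measure_display} {T : measurableType d}.
Variables (P : probability T R) (X Y : R -> {RV P >-> R}).
Hypothesis hB : brownian_motion2 X Y.
Implicit Types (z : T -> R) (s t u : R).
Local Notation filt t := (filtration_generator X Y t t).

Lemma increment_mean z t u : 0 <= t -> t <= u -> u <= 1 ->
  measurable_fun [set: g_sigma_algebraType (filt t)] z ->
  P.-integrable setT (EFin \o z) ->
  P.-integrable setT (fun w => (z w * increment Y t u w)%:E) /\
  (\int[P]_w (z w * increment Y t u w)%:E = 0)%E.
Proof.
(* The Gaussian law is given only for t < u; at t = u the increment vanishes. *)
move=> t0; rewrite le_eqVlt => /orP[/eqP <- t1 mz iz|tu u1 mz iz].
  have -> : (fun w => (z w * increment Y t t w)%:E) = cst 0%E.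
    by apply/funext => w; rewrite /increment subrr mulr0.
  by split; [exact: integrable0|exact: integral0].
apply: (gaussian_innovation_mean (h := u - t) _ _ _ mz iz).
- by rewrite subr_gt0.
- exact: filtration_generator_measurable.
- by apply: innovationY => //; rewrite t0 (le_trans (ltW tu)).
Qed.

Lemma increment_sqr z t u : 0 <= t -> t <= u -> u <= 1 ->
  measurable_fun [set: g_sigma_algebraType (filt t)] z ->
  P.-integrable setT (EFin \o z) ->
  P.-integrable setT (fun w => (z w * increment Y t u w ^+ 2)%:E) /\
  (\int[P]_w (z w * increment Y t u w ^+ 2)%:E = (u - t)%:E * \int[P]_w (z w)%:E)%E.
Proof.
move=> t0; rewrite le_eqVlt => /orP[/eqP <- t1 mz iz|tu u1 mz iz].
  have -> : (fun w => (z w * increment Y t t w ^+ 2)%:E) = cst 0%E.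
    by apply/funext => w; rewrite /increment subrr expr0n mulr0.
  by rewrite subrr mul0e; split; [exact: integrable0|exact: integral0].
apply: (gaussian_innovation_sqr (h := u - t) _ _ _ mz iz).
- by rewrite subr_gt0.
- exact: filtration_generator_measurable.
- by apply: innovationY => //; rewrite t0 (le_trans (ltW tu)).
Qed.

Lemma increment_sq_integrable z t u : 0 <= t -> t <= u -> u <= 1 ->
  measurable_fun [set: g_sigma_algebraType (filt t)] z ->
  sq_integrable P z -> sq_integrable P (fun w => z w * increment Y t u w).
Proof.
move=> t0 tu u1 mz [mz' iz2]; split.
  by apply: measurable_funM => //; exact: measurable_increment.
under eq_fun do rewrite exprMn.
by case: (@increment_sqr (fun w => z w ^+ 2) t u) => //; exact: measurable_funX.
Qed.

(** The length of the intersection of ]a, b] and ]c, e]. It is both the covariance of the two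
    increments and the integral of the product of the indicators, which is the isometry for two
    terms. *)
Definition overlap (a b c e : R) : R := Num.max 0 (Num.min b e - Num.max a c).

Lemma overlapC a b c e : overlap a b c e = overlap c e a b.
Proof. by rewrite /overlap minC (maxC a). Qed.

Lemma increment_measurable_filtration a b c : 0 <= a <= c -> 0 <= b <= c ->
  measurable_fun [set: g_sigma_algebraType (filt c)] (increment Y a b).
Proof. by move=> ac bc; apply: measurable_funB; exact: measurable_filtrationY. Qed.

(* Splitting the increments at the endpoints of the overlap, only the square of
   the increment over the overlap has a nonzero mean. *)
Let elementary_covariance_le (xi eta : T -> R) a b c e :
  0 <= a -> a <= b -> b <= 1 -> a <= c -> c <= e -> e <= 1 ->
  measurable_fun [set: g_sigma_algebraType (filt a)] xi -> sq_integrable P xi ->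
  measurable_fun [set: g_sigma_algebraType (filt c)] eta -> sq_integrable P eta ->
  (\int[P]_w ((xi w * increment Y a b w) * (eta w * increment Y c e w))%:E =
   (overlap a b c e)%:E * \int[P]_w (xi w * eta w)%:E)%E.
Proof.
move=> a0 ab b1 ac ce e1 mxi xi2 meta eta2.
have c0 : 0 <= c := le_trans a0 ac.
have mxic : measurable_fun [set: g_sigma_algebraType (filt c)] xi.
  exact: measurable_filtrationS mxi.
have ixe := sq_integrableM xi2 eta2.
rewrite /overlap (max_r ac).
have [bc|cb] := leP b c.
  have -> : Num.max 0 (Num.min b e - c) = 0.
    by apply/max_l; rewrite subr_le0 ge_min bc.
  rewrite mul0e.
  have mz : measurable_fun [set: g_sigma_algebraType (filt c)]
      (fun w => xi w * increment Y a b w * eta w).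
    apply: measurable_funM => //; apply: measurable_funM => //.
    by apply: increment_measurable_filtration; rewrite ?a0 ?ac ?bc ?(le_trans a0).
  have [_ <-] := increment_mean c0 ce e1 mz
    (sq_integrableM (increment_sq_integrable a0 ab b1 mxi xi2) eta2).
  by apply: eq_integral => w _; congr EFin; ring.
(* The increment over ]a, b] splits at [c] and [m], the one over ]c, e] at [m]. One of the
   increments from [m] to [b] and from [m] to [e] is zero, so no product of these two remains. *)
set m := Num.min b e.
have cm : c <= m by rewrite le_min (ltW cb).
have mb : m <= b by rewrite ge_min lexx.
have me : m <= e by rewrite ge_min lexx orbT.
have m1 : m <= 1 := le_trans me e1.
have m0 : 0 <= m := le_trans c0 cm.
rewrite max_r ?subr_ge0//.
have [iA A0] := @increment_mean (fun w => xi w * increment Y a c w * eta w) c e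
  c0 ce e1 (measurable_funM (measurable_funM mxic
    (increment_measurable_filtration (introT andP (conj a0 ac)) (introT andP (conj c0 (lexx c))))) meta)
  (sq_integrableM (increment_sq_integrable a0 ac (le_trans ce e1) mxi xi2) eta2).
have mxe : measurable_fun [set: g_sigma_algebraType (filt c)] (fun w => xi w * eta w).
  exact: measurable_funM.
have [iB BE] := @increment_sqr (fun w => xi w * eta w) c m c0 cm m1 mxe ixe.
have [iz _] := @increment_mean (fun w => xi w * eta w) c m c0 cm m1 mxe ixe.
have mz : measurable_fun [set: g_sigma_algebraType (filt m)]
    (fun w => xi w * eta w * increment Y c m w).
  apply: measurable_funM; first exact: measurable_filtrationS mxe.
  by apply: increment_measurable_filtration; rewrite ?c0 ?m0 ?cm ?lexx.
have [iC C0] := increment_mean m0 mb b1 mz iz.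
have [iD D0] := increment_mean m0 me e1 mz iz.
rewrite -BE -[RHS]adde0 -[X in (_ + X)%E]C0 -integralD//.
rewrite -[RHS]adde0 -[X in (_ + X)%E]D0 -integralD//; last exact: integrableD.
rewrite -[RHS]add0e -[X in (X + _)%E]A0 -integralD//; last first.
  by do 2 apply: integrableD => //.
apply: eq_integral => w _; rewrite -!EFinD; congr EFin.
by rewrite /increment /m; case: leP => _; ring.
Qed.

Lemma elementary_covariance (xi eta : T -> R) a b c e :
  0 <= a -> a <= b -> b <= 1 -> 0 <= c -> c <= e -> e <= 1 ->
  measurable_fun [set: g_sigma_algebraType (filt a)] xi -> sq_integrable P xi ->
  measurable_fun [set: g_sigma_algebraType (filt c)] eta -> sq_integrable P eta ->
  (\int[P]_w ((xi w * increment Y a b w) * (eta w * increment Y c e w))%:E =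
   (overlap a b c e)%:E * \int[P]_w (xi w * eta w)%:E)%E.
Proof.
move=> a0 ab b1 c0 ce e1 mxi xi2 meta eta2; have [ac|/ltW ca] := leP a c.
  exact: elementary_covariance_le.
under eq_integral do rewrite mulrC.
under [in RHS]eq_integral do rewrite mulrC.
by rewrite overlapC; exact: elementary_covariance_le.
Qed.

Lemma integral_overlap a b c e : 0 <= a -> b <= 1 ->
  0 <= c -> e <= 1 ->
  (\int[lebesgue_measure]_(s in `[0%R, 1%R]) (\1_(`]a, b]) s * \1_(`]c, e]) s : R)%:E =
   (overlap a b c e)%:E)%E.
Proof.
move=> a0 b1 c0 e1.
have Is : [set` `]Num.max a c, Num.min b e]%R] `&` `[0, 1] = [set` `]Num.max a c, Num.min b e]%R] :> set R.
  apply/setIidl => s /=; rewrite !in_itv/= gt_max le_min => /andP[/andP[as_ _] /andP[sb _]].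
  by rewrite (le_trans a0 (ltW as_)) (le_trans sb b1).
transitivity (\int[lebesgue_measure]_(s in `[0%R, 1%R])
    (\1_([set` `]Num.max a c, Num.min b e]%R]) s : R)%:E)%E.
  by apply: eq_integral => s _; rewrite -setI_itv_oc indicI.
rewrite integral_indic//= Is lebesgue_measure_itv/= lte_fin /overlap.
case: ltP => h.
  by rewrite [Num.max 0 _]max_r ?EFinB// subr_ge0 ltW.
by rewrite [Num.max 0 _]max_l// subr_le0.
Qed.

(** The explicit dependence on [s] shows that this expectation is finite and measurable in time. *)
Lemma integral_sum_indic_sqr (I : finType) (xi : I -> T -> R) (l r : I -> R) s :
  (forall i, sq_integrable P (xi i)) ->
  (\int[P]_w ((\sum_i xi i w * \1_(`]l i, r i]) s) ^+ 2)%:E =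
   (\sum_i \sum_j fine (\int[P]_w (xi i w * xi j w)%:E)%E *
      (\1_(`]l i, r i]) s * \1_(`]l j, r j]) s))%:E)%E.
Proof.
move=> xi2; have ixi i j := sq_integrableM (xi2 i) (xi2 j).
under eq_integral do rewrite expr2 big_distrlr/=.
rewrite integral_sum2_EFin//; last first.
  move=> i j; under eq_fun do rewrite mulrACA mulrC EFinM.
  by apply: integrableZl.
rewrite -sumEFin; apply: eq_bigr => i _.
rewrite -sumEFin; apply: eq_bigr => j _.
under eq_integral do rewrite mulrACA mulrC EFinM.
rewrite integralZl// [RHS]EFinM fineK; first exact: muleC.
exact: (integrable_fin_num measurableT (ixi i j)).
Qed.

Lemma measurable_integral_sum_indic_sqr (I : finType) (xi : I -> T -> R) (l r : I -> R) :
  (forall i, sq_integrable P (xi i)) ->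
  measurable_fun [set: R] (fun s =>
    fine (\int[P]_w ((\sum_i xi i w * \1_(`]l i, r i]) s) ^+ 2)%:E)%E).
Proof.
move=> xi2; under eq_fun do rewrite integral_sum_indic_sqr//=.
apply: measurable_sum => i; apply: measurable_sum => j.
by apply: measurable_funM => //; apply: measurable_funM; apply: measurable_indic.
Qed.

(** The intervals may overlap. The difference of two step processes on unrelated subdivisions is
    thus covered directly, without a common refinement. *)
Lemma ito_isometry (I : finType) (xi : I -> T -> R) (l r : I -> R) :
  (forall i, [/\ 0 <= l i, l i <= r i & r i <= 1]) ->
  (forall i, measurable_fun [set: g_sigma_algebraType (filt (l i))] (xi i)) ->
  (forall i, sq_integrable P (xi i)) ->
  (\int[P]_w ((\sum_i xi i w * increment Y (l i) (r i) w) ^+ 2)%:E =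
   \int[lebesgue_measure]_(s in `[0%R, 1%R])
     \int[P]_w ((\sum_i xi i w * \1_(`]l i, r i]) s) ^+ 2)%:E)%E.
Proof.
move=> lr mxi xi2.
have ixi i j := sq_integrableM (xi2 i) (xi2 j).
pose g i j : R := fine (\int[P]_w (xi i w * xi j w)%:E)%E.
have gE i j : (\int[P]_w (xi i w * xi j w)%:E = (g i j)%:E)%E.
  by rewrite fineK//; exact: (integrable_fin_num measurableT (ixi i j)).
have iind i j : lebesgue_measure.-integrable `[0, 1]
    (fun s : R => (\1_(`]l i, r i]) s * \1_(`]l j, r j]) s : R)%:E).
  have -> : (fun s : R => (\1_(`]l i, r i]) s * \1_(`]l j, r j]) s : R)%:E) =
      EFin \o (\1_([set` `]Num.max (l i) (l j), Num.min (r i) (r j)]%R])).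
    by apply/funext => s; rewrite /= -setI_itv_oc indicI.
  have := integrable_indic_itv (Num.max (l i) (l j)) (Num.min (r i) (r j)) false false.
  exact: integrableS.
transitivity (\sum_i \sum_j (overlap (l i) (r i) (l j) (r j))%:E * (g i j)%:E)%E.
  under eq_integral do rewrite expr2 big_distrlr/=.
  rewrite integral_sum2_EFin//; last first.
    move=> i j; apply: sq_integrableM; apply: increment_sq_integrable => //;
      by have [] := lr i; have [] := lr j.
  apply: eq_bigr => i _; apply: eq_bigr => j _; rewrite -gE.
  by have [? ? ?] := lr i; have [? ? ?] := lr j; exact: elementary_covariance.
transitivity (\int[lebesgue_measure]_(s in `[0%R, 1%R]) (\sum_i \sum_j
    g i j * (\1_(`]l i, r i]) s * \1_(`]l j, r j]) s))%:E)%E; last first.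
  by apply: eq_integral => s _; rewrite integral_sum_indic_sqr.
rewrite integral_sum2_EFin//; last first.
  move=> i j; have := @integrableZl _ _ _ lebesgue_measure `[0%R, 1%R]
    (measurable_itv _) (g i j) _ (iind i j).
  exact.
apply: eq_bigr => i _; apply: eq_bigr => j _.
under eq_integral do rewrite EFinM.
rewrite integralZl// muleC; congr (_ * _)%E.
by have [? ? ?] := lr i; have [? ? ?] := lr j; rewrite integral_overlap.
Qed.

End BrownianSquareIntegrable.

(* The expectation inside [is_ito_integral] is not known to be measurable in the
   time variable; monotonicity survives because the integral of a nonnegative
   function is a supremum over the simple functions below it. *)
Lemma ge0_le_integral_lower d (T : measurableType d) (R : realType)
    (mu : {measure set T -> \bar R}) (D : set T) (f g : T -> \bar R) :
  (forall x, D x -> (0 <= f x)%E) -> (forall x, D x -> (f x <= g x)%E) ->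
  (\int[mu]_(x in D) f x <= \int[mu]_(x in D) g x)%E.
Proof.
move=> f0 fg; have g0 x : D x -> (0 <= g x)%E.
  by move=> Dx; apply: le_trans (f0 _ Dx) (fg _ Dx).
rewrite !ge0_integralE//; apply: ge_ereal_sup => _ [h hf <-].
apply: ereal_sup_ubound; exists h => // x; apply: le_trans (hf x) _.
rewrite !patchE; case: ifPn => // xD; apply: fg.
by rewrite inE in xD.
Qed.

Section L2Identities.
Context {R : realType} {d : measure_display} {T : measurableType d}.
Variables (P : probability T R).

Lemma integral_sqrD_le (f g : T -> R) : measurable_fun setT f ->
  measurable_fun setT g ->
  (\int[P]_w ((f w + g w) ^+ 2)%:E <=
   2%:E * \int[P]_w (f w ^+ 2)%:E + 2%:E * \int[P]_w (g w ^+ 2)%:E)%E.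
Proof.
move=> mf mg.
have m2 (k : T -> R) : measurable_fun setT k ->
    measurable_fun setT (fun w => (k w ^+ 2)%:E).
  by move=> mk; apply/measurable_EFinP; exact: measurable_funX.
have k2 (k : T -> R) w : setT w -> (0 <= (k w ^+ 2)%:E)%E.
  by rewrite lee_fin sqr_ge0.
rewrite -!ge0_integralZl_EFin//; try exact: m2; try exact: k2.
rewrite -ge0_integralD//; last 4 first.
- by move=> w _; rewrite -EFinM lee_fin mulr_ge0// sqr_ge0.
- by apply: emeasurable_funM => //; exact: m2.
- by move=> w _; rewrite -EFinM lee_fin mulr_ge0// sqr_ge0.
- by apply: emeasurable_funM => //; exact: m2.
apply: ge0_le_integral_lower => w _; first by rewrite lee_fin sqr_ge0.
rewrite -!EFinM -EFinD lee_fin.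
by have := sqr_ge0 (f w - g w); nra.
Qed.

End L2Identities.

(** * Comparison of the Ito integral with its grid sums *)

Section BrownianPath.
Context {R : realType} {d : measure_display} {T : measurableType d}.
Variables (P : probability T R) (X Y : R -> {RV P >-> R}).
Hypothesis hB : brownian_motion2 X Y.
Implicit Types (s t : R).

Lemma brownian_increment_sqr s t : 0 <= s -> s <= t -> t <= 1 ->
  (\int[P]_w ((X t w - X s w) ^+ 2)%:E = (t - s)%:E)%E.
Proof.
move=> s0 st t1.
have [_] := @increment_sqr _ _ _ _ _ _ (brownian_motion2C hB) (fun=> 1) s t s0 st t1
  (measurable_cst _) (finite_measure_integrable_cst P 1 measurableT).
rewrite integral_cst// mul1e [X in (_ * X)%E]probability_setT mule1 => <-.
by apply: eq_integral => w _; rewrite mul1r.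
Qed.

Lemma brownian0_sqr : (\int[P]_w ((X 0 w) ^+ 2)%:E = 0)%E.
Proof.
have [[X0 _ _ _] _ _] := hB.
rewrite (ae_eq_integral (cst 0%E))//; first exact: integral0.
  by apply/measurable_EFinP; exact: measurable_funX.
by apply: filterS X0 => w -> _; rewrite expr0n.
Qed.

Lemma brownian_sq_integrable t : 0 <= t <= 1 -> sq_integrable P (X t).
Proof.
move=> /andP[t0 t1].
have hX0 : sq_integrable P (X 0).
  split=> //; apply/integrableP; split.
    by apply/measurable_EFinP; exact: measurable_funX.
  under eq_integral do rewrite gee0_abs ?lee_fin ?sqr_ge0//.
  by rewrite brownian0_sqr.
have hXt : sq_integrable P (fun w => X t w - X 0 w).
  split=> //; first exact: measurable_funB.
  apply/integrableP; split.
    by apply/measurable_EFinP; apply: measurable_funX; exact: measurable_funB.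
  under eq_integral do rewrite gee0_abs ?lee_fin ?sqr_ge0//.
  by rewrite brownian_increment_sqr// ltry.
have := sq_integrableD hXt hX0.
by under eq_fun do rewrite subrK.
Qed.

(* The left-endpoint interpolation of the path; [ito_sum] is its elementary
   integral. *)
Definition grid_val (h : R) (n : nat) (s : R) (w : T) : R :=
  \sum_(j < n) X (j%:R * h) w * \1_(`]j%:R * h, j.+1%:R * h]) s.

Lemma grid_val_eq h n j s w : 0 < h -> (j < n)%N ->
  j%:R * h < s -> s <= j.+1%:R * h -> grid_val h n s w = X (j%:R * h) w.
Proof.
move=> h0 jn js sj; rewrite /grid_val (bigD1 (Ordinal jn))//= big1 => [|i ij].
  by rewrite addr0 indicE mem_set ?mulr1//= in_itv/= js sj.
rewrite indicE memNset ?mulr0//= in_itv/= => /andP[is_ si].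
have := lt_le_trans js si; have := lt_le_trans is_ sj.
rewrite !ltr_pM2r// !ltr_nat !ltnS => ij' ji'.
by move/negP: ij; apply; apply/eqP/val_inj/eqP; rewrite /= eqn_leq ij' ji'.
Qed.

Lemma grid_val0 h n w : 0 <= h -> grid_val h n 0 w = 0.
Proof.
move=> h0; rewrite /grid_val big1// => i _.
by rewrite indicE memNset ?mulr0//= in_itv/= ltNge mulr_ge0.
Qed.

Lemma grid_cell h n s : 0 < h -> 0 < s -> s <= n%:R * h ->
  exists2 j, (j < n)%N & j%:R * h < s <= j.+1%:R * h.
Proof.
move=> h0 s0; elim: n => [|n IH] sn.
  by move: sn; rewrite mul0r leNgt s0.
have [/IH[j jn js]|ns] := leP s (n%:R * h); last by exists n => //; rewrite ns sn.
by exists j => //; exact: leqW.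
Qed.

Lemma grid_val_error n s : 0 <= s <= 1 ->
  (\int[P]_w ((X s w - grid_val n.+1%:R^-1 n.+1 s w) ^+ 2)%:E <=
   (n.+1%:R^-1)%:E)%E.
Proof.
move=> /andP[s0 s1]; set h : R := n.+1%:R^-1; have h0 : 0 < h by rewrite invr_gt0.
have [s0'|s_gt0] := eqVneq s 0.
  rewrite s0'; under eq_integral do rewrite grid_val0 ?ltW// subr0.
  by rewrite brownian0_sqr lee_fin ltW.
have nh : n.+1%:R * h = 1 by rewrite mulfV.
have sp : 0 < s by rewrite lt_neqAle eq_sym s_gt0.
have sn : s <= n.+1%:R * h by rewrite nh.
have [j jn /andP[js sj]] := grid_cell h0 sp sn.
under eq_integral do rewrite (grid_val_eq _ h0 jn js sj).
rewrite brownian_increment_sqr//; last 2 first.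
- by rewrite mulr_ge0// ltW.
- exact: ltW.
by move: sj; rewrite lee_fin -natr1 mulrDl mul1r lerBlDl.
Qed.

Local Notation spl := (@simple_process _ _ T (natural_filtration2 X Y)).

(** One index set for the intervals of [H] and the grid cells, the latter with a minus sign in the
    coefficients. The boolean, read as 0 or 1, selects the left or right endpoint. *)
Let cell_time (H : spl) h n (b : bool) (i : 'I_(sp_size H) + 'I_n) : R :=
  match i with
  | inl i => sp_time H (b + i)%N
  | inr j => (b + j)%:R * h
  end.

Let cell_coef (H : spl) h n (i : 'I_(sp_size H) + 'I_n) (w : T) : R :=
  match i with
  | inl i => sp_coef H i w
  | inr j => - X (j%:R * h) w
  end.

Let sp_time_bounds (H : spl) i : (i < sp_size H)%N ->
  [/\ 0 <= sp_time H i, sp_time H i <= sp_time H i.+1 & sp_time H i.+1 <= 1].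
Proof.
have [t0 tm t1] := sp_subdivision H.
have tge0 j : (j <= sp_size H)%N -> 0 <= sp_time H j.
  elim: j => // j IH js; apply: le_trans (IH (ltnW js)) _; exact: tm.
have tle1 j : (j <= sp_size H)%N -> sp_time H (sp_size H - j) <= 1.
  elim: j => [|j IH js]; first by rewrite subn0.
  apply: le_trans (IH (ltnW js)); rewrite -(subnSK js); apply: tm.
  by rewrite ltn_subrL/= (leq_ltn_trans _ js).
move=> ilt; split; [by apply: tge0; exact: ltnW|exact: tm|].
by have := tle1 _ (leq_subr i.+1 (sp_size H)); rewrite subKn.
Qed.

Lemma simple_process_measurable (H : spl) i : (i < sp_size H)%N ->
  measurable_fun setT (sp_coef H i).
Proof.
move=> il; apply: (@measurable_fun_sub_sigma _ _ _ _
  (filtration_generator X Y (sp_time H i) (sp_time H i))).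
  exact: filtration_generator_measurable.
by move=> _ V mV; rewrite setTI; exact: (sp_adapted il mV).
Qed.

(** The second conclusion supplies a measurable function of time, needed when the error of [H]
    against X itself is brought in. *)
Lemma simple_process_isometry (H : spl) n (h := n.+1%:R^-1 : R) :
  (\int[P]_w ((sp_integral H Y w - ito_sum X Y h n.+1 w) ^+ 2)%:E =
   \int[lebesgue_measure]_(s in `[0%R, 1%R])
     \int[P]_w ((sp_val H s w - grid_val h n.+1 s w) ^+ 2)%:E)%E /\
  exists2 phi : R -> R, measurable_fun setT phi & forall s,
    (\int[P]_w ((sp_val H s w - grid_val h n.+1 s w) ^+ 2)%:E = (phi s)%:E)%E.
Proof.
have h0 : 0 < h by rewrite invr_gt0.
have nh : n.+1%:R * h = 1 by rewrite mulfV.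
have jh (j : 'I_n.+1) : 0 <= j%:R * h <= 1.
  by rewrite mulr_ge0 ?(ltW h0)//= -[leRHS]nh ler_pM2r// ler_nat ltnW.
have c2 i : sq_integrable P (@cell_coef H h n.+1 i).
  case: i => [i|j] /=.
    have [M HM] := sp_bounded (ltn_ord i).
    apply: sq_integrable_bounded HM.
    exact: simple_process_measurable.
  have := sq_integrableZ (-1) (brownian_sq_integrable (jh j)).
  by under eq_fun do rewrite mulN1r.
have E1 w : sp_integral H Y w - ito_sum X Y h n.+1 w =
    \sum_i @cell_coef H h n.+1 i w *
      increment Y (@cell_time H h n.+1 false i) (@cell_time H h n.+1 true i) w.
  rewrite big_sumType/=; congr (_ + _).
  by rewrite -sumrN; apply: eq_bigr => j _; rewrite mulNr.
have E2 s w : sp_val H s w - grid_val h n.+1 s w =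
    \sum_i @cell_coef H h n.+1 i w *
      \1_(`]@cell_time H h n.+1 false i, @cell_time H h n.+1 true i]) s.
  rewrite big_sumType/=; congr (_ + _).
  by rewrite -sumrN; apply: eq_bigr => j _; rewrite mulNr.
split; last first.
  have := measurable_integral_sum_indic_sqr (@cell_time H h n.+1 false)
    (@cell_time H h n.+1 true) c2.
  set phi := fun s => _ => mphi; exists phi => // s.
  by under eq_integral do rewrite E2; rewrite /phi integral_sum_indic_sqr.
under eq_integral do rewrite E1.
under [RHS]eq_integral do under eq_integral do rewrite E2.
apply: (ito_isometry hB) => //.
  case=> [i|j] /=; first exact: (sp_time_bounds (ltn_ord i)).
  split; [by case/andP: (jh j)|by rewrite ler_pM2r// ler_nat|].
  by rewrite -[leRHS]nh ler_pM2r// ler_nat.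
case=> [i|j] /=.
  by move=> _ V mV; rewrite setTI; exact: (sp_adapted (ltn_ord i) mV).
apply: measurableT_comp => //; apply: measurable_filtrationX.
by case/andP: (jh j) => -> _ /=.
Qed.

Lemma measurable_sp_val (H : spl) s : measurable_fun setT (sp_val H s).
Proof.
apply: measurable_sum => i; apply: measurable_funM => //.
exact: simple_process_measurable.
Qed.

Lemma measurable_sp_integral (H : spl) : measurable_fun setT (sp_integral H Y).
Proof.
apply: measurable_sum => i; apply: measurable_funM.
  exact: simple_process_measurable.
exact: measurable_funB.
Qed.

Lemma measurable_ito_sum h n : measurable_fun setT (ito_sum X Y h n).
Proof.
apply: measurable_sum => i; apply: measurable_funM => //.
exact: measurable_increment.
Qed.

Lemma simple_process_error (H : spl) n (h := n.+1%:R^-1 : R) :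
  (\int[P]_w ((sp_integral H Y w - ito_sum X Y h n.+1 w) ^+ 2)%:E <=
   2%:E * (\int[lebesgue_measure]_(s in `[0%R, 1%R])
     \int[P]_w ((X s w - sp_val H s w) ^+ 2)%:E) + (2 * h)%:E)%E.
Proof.
have h0 : 0 < h by rewrite invr_gt0.
have [-> [phi mphi phiE]] := simple_process_isometry H n.
pose g s := (\int[P]_w ((X s w - sp_val H s w) ^+ 2)%:E)%E.
have g0 s : (0 <= g s)%E by apply: integral_ge0 => w _; rewrite lee_fin sqr_ge0.
have phi_le s : s \in `[0, 1] -> ((phi s)%:E <= 2%:E * g s + (2 * h)%:E)%E.
  rewrite in_itv/= => s01; rewrite -phiE.
  have E w : sp_val H s w - grid_val h n.+1 s w =
      (-1 * (X s w - sp_val H s w)) + (X s w - grid_val h n.+1 s w) by ring.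
  under eq_integral do rewrite E.
  apply: le_trans (integral_sqrD_le _ _ _) _.
  - by apply: measurable_funM => //; apply: measurable_funB => //; exact: measurable_sp_val.
  - apply: measurable_funB => //; apply: measurable_sum => j.
    exact: measurable_funM.
  rewrite EFinM; apply: leeD.
    rewrite lee_pmul2l//.
    by under eq_integral do rewrite exprMn sqrrN expr1n mul1r.
  by rewrite lee_pmul2l//; exact: grid_val_error.
(* A measurable minorant of [g], obtained by solving phi <= 2 g + 2h for [g]. The integral is split
   with [psi], and monotonicity alone then passes to [g]. *)
pose psi s := Num.max 0 (phi s / 2 - h).
have psi0 s : 0 <= psi s by rewrite /psi le_max lexx.
have psi_le s : s \in `[0, 1] -> ((psi s)%:E <= g s)%E.
  move=> s01; have := phi_le s s01; have := g0 s.
  case: (g s) => [r| |]; [|by move=> _ _; rewrite leey|by []].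
  rewrite !lee_fin => r0 H'; rewrite /psi ge_max r0/=; lra.
have mpsi : measurable_fun setT psi.
  apply: measurable_maxr => //; apply: measurable_funB => //.
  exact: measurable_funM.
under eq_integral do rewrite phiE.
apply: (@le_trans _ _ (\int[lebesgue_measure]_(s in `[0%R, 1%R])
    (2%:E * (psi s)%:E + (2 * h)%:E)))%E.
  apply: ge0_le_integral_lower => s _.
    by rewrite -phiE; apply: integral_ge0 => w _; rewrite lee_fin sqr_ge0.
  rewrite -EFinM -EFinD lee_fin.
  have : phi s / 2 - h <= psi s by rewrite /psi le_max lexx orbT.
  lra.
rewrite ge0_integralD//; last 3 first.
- by move=> s _; rewrite -EFinM lee_fin mulr_ge0.
- by apply: emeasurable_funM => //; apply/measurable_EFinP; exact: measurable_funTS.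
- by move=> s _; rewrite lee_fin mulr_ge0// ltW.
apply: leeD; last first.
  rewrite integral_cst//= lebesgue_measure_itv/= lte_fin ltr01 -EFinB subr0.
  by rewrite mule1.
rewrite ge0_integralZl_EFin//; last 2 first.
- by move=> s _; rewrite lee_fin.
- by apply/measurable_EFinP; exact: measurable_funTS.
rewrite lee_pmul2l//; apply: ge0_le_integral_lower => s s01.
  by rewrite lee_fin.
by apply: psi_le; rewrite inE in s01 *.
Qed.

Lemma ito_sum_error (I : {RV P >-> R}) n (h := n.+1%:R^-1 : R) :
  is_ito_integral P (natural_filtration2 X Y) X Y I ->
  (\int[P]_w ((I w - ito_sum X Y h n.+1 w) ^+ 2)%:E <= (4 * h)%:E)%E.
Proof.
(* Both approximation errors are made at most eps/6. Applying (f + g)^2 <= 2f^2 + 2g^2 twice weights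
   them by 2 and 4, total eps, and turns the grid error h into 4h. *)
move=> [Hk [G0 e0]]; apply/lee_addgt0Pr => eps eps0.
have ep : (0%:E < (eps / 6)%:E)%E by rewrite lte_fin divr_gt0.
have : \forall k \near \oo, ((\int[lebesgue_measure]_(s in `[0%R, 1%R])
       'E_P[fun w => ((X s w - sp_val (Hk k) s w) ^+ 2)%R]) < (eps / 6)%:E)%E.
  exact: (G0 _ (open_ereal_lt' ep)).
have : \forall k \near \oo,
    ('E_P[fun w => ((I w - sp_integral (Hk k) Y w) ^+ 2)%R] < (eps / 6)%:E)%E.
  exact: (e0 _ (open_ereal_lt' ep)).
move=> He HG; have [k _ /(_ k (leqnn k)) [Hek HGk]] := filterI He HG.
rewrite unlock in Hek HGk.
have E w : I w - ito_sum X Y h n.+1 w = (I w - sp_integral (Hk k) Y w) +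
   (sp_integral (Hk k) Y w - ito_sum X Y h n.+1 w) by rewrite addrA subrK.
under eq_integral do rewrite E.
have mJ := measurable_sp_integral (Hk k); have mS := measurable_ito_sum h n.+1.
apply: le_trans (integral_sqrD_le _ (measurable_funB _ mJ) (measurable_funB mJ mS)) _ => //.
have HJ := simple_process_error (Hk k) n.
apply: (@le_trans _ _ (2%:E * (eps / 6)%:E + 2%:E * (2%:E * (eps / 6)%:E + (2 * h)%:E)))%E.
  apply: leeD; rewrite lee_pmul2l//; first exact: ltW.
  apply: le_trans HJ _; apply: leeD => //; rewrite lee_pmul2l//; exact: ltW.
by rewrite -!(EFinM, EFinD) lee_fin; lra.
Qed.

End BrownianPath.

(** * Passage to the limit *)

Section ExponentialLimit.
Context {R : realType}.

Lemma expR_sub_le (a b : R) : expR a - expR b <= `|a - b| * (expR a + expR b).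
Proof.
have ea := expR_gt0 a; have eb := expR_gt0 b.
have : expR a * (1 - (a - b)) <= expR b.
  have := expR_ge1Dx (- (a - b)); rewrite -(ler_pM2l ea) -expRD.
  by have -> : a + - (a - b) = b by ring.
have := ler_norm (a - b); have := normr_ge0 (a - b); nra.
Qed.

(* AM-GM with weight [lam] turns the product into integrable squares. *)
Lemma expR_le_quadratic (lam a b : R) : 0 < lam ->
  expR a <= expR b + lam * (a - b) ^+ 2 + (expR (2 * a) + expR (2 * b)) / (2 * lam).
Proof.
move=> l0; have := expR_sub_le a b.
have e2 (x : R) : expR (2 * x) = expR x ^+ 2 by rewrite expr2 -expRD mulr2n mulrDl mul1r.
rewrite !e2 -(real_normK (num_real (a - b))); set u := `|a - b|; set x := expR a; set y := expR b.
move=> H; rewrite -addrA -lerBlDl.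
have -> : lam * u ^+ 2 + (x ^+ 2 + y ^+ 2) / (2 * lam) =
   (2 * (lam * u) ^+ 2 + x ^+ 2 + y ^+ 2) / (2 * lam) by field; rewrite gt_eqF.
rewrite ler_pdivlMr ?mulr_gt0//.
have : (x - y) * (2 * lam) <= u * (x + y) * (2 * lam) by rewrite ler_pM2r// mulr_gt0.
have := sqr_ge0 (lam * u - x); have := sqr_ge0 (lam * u - y).
nra.
Qed.

(** Monotone convergence of the truncations. It bounds the integral of exp(z A), whose finiteness is
    not known beforehand. *)
Lemma integral_le_of_truncation d (T : measurableType d)
    (mu : {measure set T -> \bar R}) (f : T -> R) (C : \bar R) :
  measurable_fun setT f -> (forall x, 0 <= f x) ->
  (forall m : nat, (\int[mu]_x (Num.min (f x) m%:R)%:E <= C)%E) ->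
  (\int[mu]_x (f x)%:E <= C)%E.
Proof.
move=> mf f0 fC; pose g (m : nat) x := (Num.min (f x) m%:R)%:E.
have gf x : g ^~ x @ \oo --> (f x)%:E.
  apply: cvg_near_cst; near=> m; rewrite /g; congr EFin; apply/min_l.
  by near: m; exact: nbhs_infty_ger.
have gl x : limn (g ^~ x) = (f x)%:E by apply/cvg_lim.
have := @cvg_monotone_convergence _ _ _ mu setT measurableT g.
move=> H; have {}H : (\int[mu]_x g m x @[m --> \oo] --> \int[mu]_x limn (g ^~ x))%E.
  apply: H.
  - by move=> m; apply/measurable_EFinP; apply: measurable_minr.
  - by move=> m x _; rewrite lee_fin le_min f0 ler0n.
  - move=> x _ m n mn; rewrite lee_fin le_min ge_min lexx/= ge_min.
    by rewrite ler_nat mn orbT.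
under eq_integral do rewrite -gl.
by apply: cvge_to_le H _; near=> m; exact: fC.
Unshelve. all: by end_near. Qed.

Variables (d : measure_display) (T : measurableType d) (P : probability T R).
Variables (A : T -> R) (B : nat -> T -> R) (delta : nat -> R).
Hypotheses (mA : measurable_fun setT A) (mB : forall n, measurable_fun setT (B n)).
Hypothesis AB : forall n, (\int[P]_w ((A w - B n w) ^+ 2)%:E <= (delta n)%:E)%E.
Hypothesis delta0 : delta n @[n --> \oo] --> (0 : R).

Let mexp (f : T -> R) (c : R) : measurable_fun setT f ->
  measurable_fun setT (fun w => (expR (c * f w))%:E).
Proof.
by move=> mf; apply/measurable_EFinP; apply: measurableT_comp => //; exact: measurable_funM.
Qed.

Let mAB n (c : R) : measurable_fun setT (fun w => (c * (A w - B n w) ^+ 2)%:E).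
Proof.
apply/measurable_EFinP; apply: measurable_funM => //; apply: measurable_funX.
exact: measurable_funB.
Qed.

Let AB_le (c : R) n : 0 <= c ->
  (\int[P]_w (c * (A w - B n w) ^+ 2)%:E <= (c * delta n)%:E)%E.
Proof.
move=> c0; under eq_integral do rewrite EFinM.
rewrite ge0_integralZl_EFin//.
- by rewrite EFinM; apply: lee_wpmul2l => //; rewrite lee_fin.
- by move=> w _; rewrite lee_fin sqr_ge0.
- by have := mAB n 1; under eq_fun do rewrite mul1r.
Qed.

(* min(exp(z A), m) <= e exp(z B) + m (A - B)^2: the first term dominates where
   |A - B| <= 1, the second elsewhere. *)
Lemma mgf_limit_bound (z C : R) : `|z| <= 1 ->
  (forall n, \int[P]_w (expR (z * B n w))%:E <= C%:E)%E ->
  (\int[P]_w (expR (z * A w))%:E <= (expR 1 * C)%:E)%E.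
Proof.
move=> z1 BC; apply: integral_le_of_truncation.
- by apply: measurableT_comp => //; exact: measurable_funM.
- by move=> w; exact: expR_ge0.
move=> m.
have key n : (\int[P]_w (Num.min (expR (z * A w)) m%:R)%:E <=
    (expR 1 * C + m%:R * delta n)%:E)%E.
  apply: (@le_trans _ _ (\int[P]_w ((expR 1)%:E * (expR (z * B n w))%:E +
      (m%:R * (A w - B n w) ^+ 2)%:E)))%E.
    apply: ge0_le_integral_lower => w _.
      by rewrite lee_fin le_min expR_ge0 ler0n.
    rewrite -EFinM -EFinD lee_fin -expRD ge_min.
    have [h|h] := leP `|A w - B n w| 1.
      apply/orP; left; apply: ler_wpDr; first by rewrite mulr_ge0 ?sqr_ge0.
      rewrite ler_expR -lerBlDr -mulrBr; apply: le_trans (ler_norm _) _.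
      by rewrite normrM mulr_ile1.
    apply/orP; right; apply: ler_wpDl; first exact: expR_ge0.
    by rewrite ler_peMr// -real_normK ?num_real// exprn_ege1// ltW.
  rewrite ge0_integralD//; last 2 first.
  - by apply: emeasurable_funM => //; exact: mexp.
  - by move=> w _; rewrite lee_fin mulr_ge0 ?sqr_ge0.
  rewrite ge0_integralZl_EFin ?expR_ge0//; last exact: mexp.
  by rewrite EFinD; apply: leeD; [rewrite EFinM lee_pmul2l ?lte_fin ?expR_gt0|exact: AB_le].
have L : (expR 1 * C + m%:R * delta n)%:E @[n --> \oo] --> (expR 1 * C + m%:R * 0)%:E.
  by apply: cvg_EFin; [exact: nearW|apply: cvgD; [exact: cvg_cst|exact: cvgMl_tmp]].
rewrite mulr0 addr0 in L.
by apply: cvge_to_ge L _; exact: nearW.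
Qed.

(** The weighted quadratic bound controls the difference of the two exponentials by the L^2 distance
    and by exponential moments at 2z, which is why |2z| <= 1 is asked. *)
Lemma mgf_limit (z C m : R) (M : nat -> R) : `|2 * z| <= 1 ->
  (forall n, \int[P]_w (expR (2 * z * B n w))%:E <= C%:E)%E ->
  (forall n, \int[P]_w (expR (z * B n w))%:E = (M n)%:E)%E ->
  M n @[n --> \oo] --> m ->
  (\int[P]_w (expR (z * A w))%:E = m%:E)%E.
Proof.
move=> z1 BC BM Mm.
have AC := mgf_limit_bound z1 BC.
pose K := expR 1 * C + C.
(* Symmetric in the two functions: it is applied with A and B n in both orders, giving the upper and
   the lower bound. *)
have swap (f g : T -> R) lam n : 0 < lam -> measurable_fun setT f -> measurable_fun setT g ->
    (forall w, (f w - g w) ^+ 2 = (A w - B n w) ^+ 2) ->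
    (\int[P]_w (expR (2 * z * f w))%:E + \int[P]_w (expR (2 * z * g w))%:E <= K%:E)%E ->
    (\int[P]_w (expR (z * f w))%:E <= \int[P]_w (expR (z * g w))%:E +
     (lam * z ^+ 2 * delta n + K / (2 * lam))%:E)%E.
  move=> l0 mf mg fg fgK.
  have il0 : 0 <= (2 * lam)^-1 by rewrite invr_ge0 mulr_ge0 ?ltW.
  have c1 : 0 <= lam * z ^+ 2 by rewrite mulr_ge0 ?sqr_ge0// ltW.
  apply: (@le_trans _ _ (\int[P]_w ((expR (z * g w))%:E + ((lam * z ^+ 2 * (A w - B n w) ^+ 2)%:E +
     ((2 * lam)^-1)%:E * ((expR (2 * z * f w))%:E + (expR (2 * z * g w))%:E))))%E).
    apply: ge0_le_integral_lower => w _; first by rewrite lee_fin expR_ge0.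
    rewrite -!(EFinM, EFinD) lee_fin -fg.
    have := expR_le_quadratic (z * f w) (z * g w) l0.
    by rewrite -mulrBr exprMn !mulrA => /le_trans; apply; rewrite addrA [_^-1 * _]mulrC.
  rewrite ge0_integralD//; last 3 first.
  - exact: mexp.
  - by move=> w _; rewrite -!(EFinM, EFinD) lee_fin addr_ge0 ?(mulr_ge0 c1) ?sqr_ge0// mulr_ge0// addr_ge0 ?expR_ge0.
  - by apply: emeasurable_funD => //; apply: emeasurable_funM => //; apply: emeasurable_funD; exact: mexp.
  apply: leeD => //.
  rewrite ge0_integralD//; last 3 first.
  - by move=> w _; rewrite lee_fin (mulr_ge0 c1) ?sqr_ge0.
  - by move=> w _; rewrite -!(EFinM, EFinD) lee_fin mulr_ge0 ?addr_ge0 ?expR_ge0.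
  - by apply: emeasurable_funM => //; apply: emeasurable_funD; exact: mexp.
  rewrite EFinD; apply: leeD; first exact: AB_le.
  rewrite ge0_integralZl_EFin//; last 2 first.
  - by move=> w _; rewrite -EFinD lee_fin addr_ge0 ?expR_ge0.
  - by apply: emeasurable_funD; exact: mexp.
  rewrite ge0_integralD//; last 2 first.
  - exact: mexp.
  - exact: mexp.
  by rewrite [K / _]mulrC EFinM; apply: lee_wpmul2l => //; rewrite lee_fin.
have C0 : 0 <= C.
  rewrite -lee_fin; apply: le_trans (BC 0%N).
  by apply: integral_ge0 => w _; rewrite lee_fin expR_ge0.
have K0 : 0 <= K by rewrite addr_ge0 ?mulr_ge0 ?expR_ge0.
pose bnd lam n := lam * z ^+ 2 * delta n + K / (2 * lam).
have ub lam n : 0 < lam -> (\int[P]_w (expR (z * A w))%:E <= (M n + bnd lam n)%:E)%E.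
  move=> l0; rewrite EFinD -BM; apply: swap => //.
  by rewrite EFinD; apply: leeD.
have lb lam n : 0 < lam -> ((M n)%:E <= \int[P]_w (expR (z * A w))%:E + (bnd lam n)%:E)%E.
  move=> l0; rewrite -BM; apply: swap => //.
    by move=> w; rewrite -sqrrN opprB.
  by rewrite addeC EFinD; apply: leeD.
have Lfin : (\int[P]_w (expR (z * A w))%:E)%E \is a fin_num.
  rewrite ge0_fin_numE; last by apply: integral_ge0 => w _; rewrite lee_fin expR_ge0.
  by rewrite (le_lt_trans (ub 1 0%N ltr01))// ltry.
rewrite -(fineK Lfin) in ub lb *; congr EFin.
set l := fine _ in ub lb *.
suff Ml : M n @[n --> \oo] --> l by apply: (cvg_unique _ Ml Mm).
apply/cvgrPdist_le => eps eps0.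
(* The weight is fixed first, so that K / (2 lam) <= eps/2; then [n] makes the term with [delta n]
   small. The 1 in K + 1 keeps [lam] positive. *)
pose lam := (K + 1) / eps.
have l0 : 0 < lam by rewrite divr_gt0// ltr_wpDl.
have Klam : K / (2 * lam) <= eps / 2.
  have K1 : 0 < K + 1 by rewrite ltr_wpDl.
  have -> : K / (2 * lam) = eps / 2 * (K / (K + 1)).
    by rewrite /lam; field; rewrite !gt_eqF.
  by rewrite ler_piMr ?divr_ge0 ?(ltW eps0)// ler_pdivrMr// mul1r lerDl.
have D0 : lam * z ^+ 2 * delta n @[n --> \oo] --> lam * z ^+ 2 * 0 by exact: cvgMl_tmp.
rewrite mulr0 in D0.
near=> n.
have dn : lam * z ^+ 2 * delta n <= eps / 2.
  by near: n; apply: (cvgr_le 0 D0); rewrite divr_gt0.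
have := ub lam n l0; have := lb lam n l0; rewrite -EFinD !lee_fin /bnd => H1 H2.
rewrite ler_norml; apply/andP; split; lra.
Unshelve. all: by end_near. Qed.

End ExponentialLimit.

Section LevyAreaMgf.
Context {R : realType} {d : measure_display} {T : measurableType d}.
Variables (P : probability T R) (X Y : R -> {RV P >-> R}) (A : {RV P >-> R}).
Hypotheses (hB : brownian_motion2 X Y) (hA : is_levy_area X Y A).

(** Both integrals of the area refer to one filtration, whereas exchanging X and Y in
    [ito_sum_error] exchanges them in the filtration too. *)
Lemma natural_filtration2C : natural_filtration2 X Y = natural_filtration2 Y X.
Proof. by apply/funext => t; rewrite /natural_filtration2 setUC. Qed.

Lemma levy_area_error n :
  (\int[P]_w ((A w - discrete_area X Y n.+1%:R^-1 n.+1 w) ^+ 2)%:E <=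
   (4 * n.+1%:R^-1)%:E)%E.
Proof.
have [I [J [hI hJ AIJ]]] := hA.
set h : R := n.+1%:R^-1.
have mS := measurable_ito_sum X Y h n.+1.
have mS' := measurable_ito_sum Y X h n.+1.
pose f w := 2^-1 * (I w - ito_sum X Y h n.+1 w).
pose g w := - 2^-1 * (J w - ito_sum Y X h n.+1 w).
have mf : measurable_fun setT f by apply: measurable_funM => //; exact: measurable_funB.
have mg : measurable_fun setT g by apply: measurable_funM => //; exact: measurable_funB.
rewrite (ae_eq_integral (fun w => ((f w + g w) ^+ 2)%:E))//; last 3 first.
- apply/measurable_EFinP; apply: measurable_funX; apply: measurable_funB => //.
  by apply: measurable_funM => //; exact: measurable_funB.
- by apply/measurable_EFinP; apply: measurable_funX; exact: measurable_funD.
- apply: filterS AIJ => w -> _; congr (_ ^+ 2)%:E.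
  by rewrite /f /g /discrete_area; ring.
apply: le_trans (integral_sqrD_le _ mf mg) _.
have half (k : T -> R) c : c ^+ 2 = 4^-1 -> measurable_fun setT k ->
    (\int[P]_w (k w ^+ 2)%:E <= (4 * h)%:E)%E ->
    (\int[P]_w ((c * k w) ^+ 2)%:E <= h%:E)%E.
  move=> c4 mk kh; under eq_integral do rewrite exprMn c4 EFinM.
  rewrite ge0_integralZl_EFin//; last 2 first.
  - by move=> w _; rewrite lee_fin sqr_ge0.
  - by apply/measurable_EFinP; exact: measurable_funX.
  apply: (@le_trans _ _ (4^-1%:E * (4 * h)%:E)%E); first by rewrite lee_pmul2l.
  by rewrite -EFinM lee_fin; lra.
have If := half (fun w => I w - ito_sum X Y h n.+1 w) (2^-1).
have Jf := half (fun w => J w - ito_sum Y X h n.+1 w) (- 2^-1).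
(* The factor 1/2 of the area, squared, reduces each error 4h to h. *)
apply: (@le_trans _ _ (2%:E * h%:E + 2%:E * h%:E)%E).
  apply: leeD; rewrite lee_pmul2l//.
    apply: If; [by field|exact: measurable_funB|exact: ito_sum_error].
  apply: Jf; [by field|exact: measurable_funB|].
  by apply: (ito_sum_error (brownian_motion2C hB)); rewrite -natural_filtration2C.
by rewrite -!(EFinM, EFinD) lee_fin; lra.
Qed.

Lemma levy_area_mgf (z : R) : `|2 * z| <= 1 ->
  (\int[P]_w (expR (z * A w))%:E = ((cos (z / 2))^-1)%:E)%E.
Proof.
move=> z1.
have z2 : `|z| <= 1 by move: z1; rewrite !ler_norml => /andP[? ?]; apply/andP; split; lra.
pose B n := discrete_area X Y n.+1%:R^-1 n.+1.
have hn n : n.+1%:R * n.+1%:R^-1 <= 1 :> R by rewrite mulfV.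
have h0 n : 0 <= n.+1%:R^-1 :> R by rewrite invr_ge0.
(* 4/3 is the inverse of the lower bound 3/4 for q, applied at 2z. *)
apply: (@mgf_limit R d T P A B (fun n => 4 * n.+1%:R^-1) _ _ _ _ z (4 / 3)
  _ (fun n => (riccati z n.+1%:R^-1 n.+1).2^-1)) => //.
- move=> n; apply: (@measurable_fun_sub_sigma _ _ _ _ (filtration_generator X Y 1 1)).
    exact: filtration_generator_measurable.
  exact: discrete_area_measurable.
- exact: levy_area_error.
- by rewrite -[X in _ --> X](mulr0 4); apply: cvgMl_tmp; exact: cvg_harmonic.
- move=> n; rewrite discrete_area_mgf// lee_fin -[leRHS]invf_div.
  have q := riccati_gt0 z1 (h0 n) (hn n).
  by rewrite lef_pV2 ?posrE ?(lt_le_trans _ q)// divr_gt0.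
- by move=> n; rewrite discrete_area_mgf.
apply: cvgV; last exact: cvg_riccati.
rewrite gt_eqF//; apply: cos_gt0_pihalf.
have := @pi_ge2 R; move: z2; rewrite ler_norml => /andP[? ?] ?.
by apply/andP; split; lra.
Qed.

End LevyAreaMgf.

(** * Moments *)

Section PseriesUnique.
Context {R : realType}.

Lemma sum_expr_le2 (q : R) k : 0 <= q -> q <= 2^-1 -> \sum_(i < k) q ^+ i <= 2.
Proof.
move=> q0 q1; elim: k => [|k IH]; first by rewrite big_ord0.
rewrite big_ord_recl expr0.
under eq_bigr do rewrite /= /bump/= add1n exprS.
rewrite -mulr_sumr.
have : q * \sum_(i < k) q ^+ i <= 2^-1 * 2.
  by apply: ler_pM => //; apply: sumr_ge0 => i _; exact: exprn_ge0.
lra.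
Qed.

(** By strong induction the lower coefficients vanish. Convergence at one point x > 0 bounds c_m
    x^m, so the terms beyond n add up to O(z^(n+1)); dividing by z^n and taking z small leaves c_n =
    0. *)
Lemma pseries_eq0 (c : nat -> R) :
  (\forall z \near (0 : R), pseries c z @ \oo --> (0 : R)) -> forall n, c n = 0.
Proof.
move=> /nbhs_ballP[r /= r0 Hr] n; elim/ltn_ind: n => n IH.
pose x := r / 2; have x0 : 0 < x by rewrite divr_gt0.
have xr : ball (0 : R) r x by rewrite /ball/= sub0r normrN gtr0_norm// /x; lra.
have [K [Kr HK]] : [bounded c m * x ^+ m | m in [set: nat]].
  by apply: cvg_series_bounded; apply/cvg_ex; exists 0; exact: Hr xr.
pose M := `|K| + 1.
have M0 : 0 < M by rewrite ltr_wpDl.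
have cM m : `|c m| <= M * x ^- m.
  have := HK M; rewrite /M (le_lt_trans (ler_norm K)) ?ltrDl// => /(_ isT m I).
  by rewrite /= normrM (gtr0_norm (exprn_gt0 m x0)) ler_pdivlMr ?exprn_gt0.
(* For z <= x/2 the tail is dominated by a geometric series of ratio at most 1/2, whose sum 2 is the
   constant here. *)
have key z : 0 < z -> z <= x / 2 -> `|c n| <= 2 * M * x ^- n.+1 * z.
  move=> z0 zx.
  have q1 : z / x <= 2^-1 by rewrite ler_pdivrMr//; lra.
  have q0 : 0 <= z / x by rewrite divr_ge0 ?ltW.
  have zn0 : 0 < z ^+ n by rewrite exprn_gt0.
  have zr : ball (0 : R) r z.
    by rewrite /ball/= sub0r normrN gtr0_norm//; apply: le_lt_trans zx _; rewrite /x; lra.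
  have bnd k : `|c n| * z ^+ n <= `|pseries c z (n + k).+1| + 2 * M * (z / x) ^+ n.+1.
    have E : pseries c z (n + k).+1 = c n * z ^+ n +
        \sum_(i < k) c (n.+1 + i)%N * z ^+ (n.+1 + i).
      rewrite /pseries /series/= -addSn (big_cat_nat (n := n.+1)) ?leq_addr//=.
      rewrite big_nat_recr//= big_nat_cond big1 ?add0r; last first.
        by move=> i /[!andbT] /= ilt; rewrite IH ?mul0r.
      congr (_ + _); rewrite -{1}[n.+1]add0n big_addn addnC addnK big_mkord.
      by apply: eq_bigr => i _; rewrite addnC.
    have tail : `|\sum_(i < k) c (n.+1 + i)%N * z ^+ (n.+1 + i)| <= 2 * M * (z / x) ^+ n.+1.
      apply: le_trans (ler_norm_sum _ _ _) _.
      apply: (@le_trans _ _ (\sum_(i < k) M * (z / x) ^+ n.+1 * (z / x) ^+ i)).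
        apply: ler_sum => i _; rewrite normrM (gtr0_norm (exprn_gt0 _ z0)).
        by rewrite -mulrA -exprD expr_div_n [z ^+ _ / _]mulrC mulrA ler_pM2r ?exprn_gt0.
      rewrite -mulr_sumr -[2 * M * _]mulrA [2 * _]mulrC.
      apply: ler_wpM2l; last exact: sum_expr_le2.
      by rewrite mulr_ge0 ?exprn_ge0// ltW.
    rewrite -(gtr0_norm zn0) -normrM.
    have -> : c n * z ^+ n = pseries c z (n + k).+1 -
        \sum_(i < k) c (n.+1 + i)%N * z ^+ (n.+1 + i) by rewrite E addrK.
    by apply: le_trans (ler_normB _ _) _; rewrite lerD2l.
  have L : `|c n| * z ^+ n <= 2 * M * (z / x) ^+ n.+1.
    apply/ler_addgt0Pr => e e0.
    have [N _ HN] : \forall m \near \oo, `|pseries c z m| <= e.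
      exact: (cvgr0_norm_le _ (Hr _ zr)).
    apply: le_trans (bnd N) _; rewrite addrC lerD2l.
    by apply: HN; rewrite /= leqW// leq_addl.
  rewrite -(ler_pM2r zn0); apply: le_trans L _.
  by rewrite expr_div_n exprSr mulrA mulrAC -!mulrA [z * _]mulrC.
apply/eqP; rewrite -normr_le0; apply/ler_addgt0Pr => e e0; rewrite add0r.
pose K2 := 2 * M * x ^- n.+1.
have K20 : 0 < K2 by rewrite !mulr_gt0// invr_gt0 exprn_gt0.
pose z := Num.min (x / 2) (e / K2).
have z0 : 0 < z by rewrite lt_min (divr_gt0 x0)//= divr_gt0.
apply: le_trans (key z z0 _) _; first by rewrite ge_min lexx.
by rewrite -/K2 mulrC -ler_pdivlMr// ge_min lexx orbT.
Qed.

Lemma pseries_unique (a b : nat -> R) (f : R -> R) :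
  (\forall z \near (0 : R), pseries a z @ \oo --> f z) ->
  (\forall z \near (0 : R), pseries b z @ \oo --> f z) -> forall n, a n = b n.
Proof.
move=> ha hb n; apply/eqP; rewrite -subr_eq0; apply/eqP.
apply: (@pseries_eq0 (fun n => a n - b n)).
apply: filterS2 ha hb => z az bz.
have -> : pseries (fun n => a n - b n) z = pseries a z \- pseries b z.
  apply/funext => m; rewrite /pseries /series/= -sumrB.
  by apply: eq_bigr => i _; rewrite mulrBl.
by rewrite -(subrr (f z)); exact: cvgB.
Qed.

End PseriesUnique.

Section MomentsOfMgf.
Context {R : realType} {d : measure_display} {T : measurableType d}.
Variables (P : probability T R) (A : T -> R) (r : R).
Hypotheses (mA : measurable_fun setT A) (r0 : 0 < r).
Hypothesis mgf_fin : forall z, `|z| <= r -> (\int[P]_w (expR (z * A w))%:E < +oo)%E.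

Let mgf_integrable z : `|z| <= r -> P.-integrable setT (fun w => (expR (z * A w))%:E).
Proof.
move=> zr; apply/integrableP; split.
  by apply/measurable_EFinP; apply: measurableT_comp => //; exact: measurable_funM.
by under eq_integral do rewrite gee0_abs ?lee_fin ?expR_ge0//; exact: mgf_fin.
Qed.

(** An integrable bound for exp|z A|, hence for all partial sums of the exponential series at z
    A. *)
Let dom z w : R := expR (z * A w) + expR (- z * A w).

Let dom_integrable z : `|z| <= r -> P.-integrable setT (fun w => (dom z w)%:E).
Proof.
move=> zr; under eq_fun do rewrite EFinD.
by apply: integrableD => //; apply: mgf_integrable => //; rewrite normrN.
Qed.

Let expR_norm_le z w : expR `|z * A w| <= dom z w.
Proof.
rewrite /dom mulNr; have [_|_] := ger0P (z * A w); first by rewrite lerDl expR_ge0.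
by rewrite lerDr expR_ge0.
Qed.

Lemma series_exp_coeff_le (x : R) n : `|series (exp_coeff x) n| <= expR `|x|.
Proof.
apply: (@le_trans _ _ (series (exp_coeff `|x|) n)).
  apply: le_trans (ler_norm_sum _ _ _) _; apply: ler_sum => i _.
  by rewrite /exp_coeff/= normrM normrX normfV (ger0_norm (ler0n _ _)).
apply: nondecreasing_cvgn_le; last exact: is_cvg_series_exp_coeff.
by apply: nondecreasing_series => i _ _; exact: exp_coeff_ge0.
Qed.

Lemma moment_integrable n : P.-integrable setT (fun w => (A w ^+ n)%:E).
Proof.
have rr : `|r| <= r by rewrite gtr0_norm.
apply: (le_integrable measurableT _ _ (integrableZl measurableT
  (2 * n`!%:R / r ^+ n) (dom_integrable rr))).
  by apply/measurable_EFinP; exact: measurable_funX.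
move=> w _; rewrite [leRHS](_ : _ = `|(2 * n`!%:R / r ^+ n * dom r w)%:E|%E)// lee_fin.
have f0 : 0 < n`!%:R :> R by rewrite ltr0n fact_gt0.
have rn0 : 0 < r ^+ n by rewrite exprn_gt0.
have dom0 : 0 <= dom r w by rewrite addr_ge0 ?expR_ge0.
rewrite [leRHS]ger0_norm; last first.
  by rewrite mulr_ge0// divr_ge0 ?mulr_ge0 ?(ltW rn0)// ltW.
(* A single term is the difference of two partial sums, each at most [dom r w]; this is the 2 in the
   factor 2 n! / r^n. *)
have E : exp_coeff (r * A w) n = series (exp_coeff (r * A w)) n.+1 -
    series (exp_coeff (r * A w)) n by rewrite /series/= big_nat_recr//= addrAC subrr add0r.
have : `|exp_coeff (r * A w) n| <= 2 * dom r w.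
  rewrite E; apply: le_trans (ler_normB _ _) _.
  rewrite mulr2n mulrDl mul1r; apply: lerD;
    exact: le_trans (series_exp_coeff_le _ _) (expR_norm_le _ _).
rewrite /exp_coeff/= exprMn !normrM normfV (gtr0_norm f0) (gtr0_norm rn0).
rewrite ler_pdivrMr// mulrC -ler_pdivlMr// => /le_trans; apply.
by rewrite [leRHS](_ : _ = 2 * dom r w * n`!%:R / r ^+ n)//; ring.
Qed.

Lemma mgf_pseries z : `|z| <= r ->
  pseries (fun n => fine (\int[P]_w (A w ^+ n)%:E)%E / n`!%:R) z @ \oo -->
  fine (\int[P]_w (expR (z * A w))%:E)%E.
Proof.
move=> zr.
pose f_ n w := (series (exp_coeff (z * A w)) n)%:E.
have fE n : (\int[P]_w f_ n w)%E =
    (pseries (fun n => fine (\int[P]_w (A w ^+ n)%:E)%E / n`!%:R) z n)%:E.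
  rewrite /f_ /pseries /series/= -sumEFin.
  under eq_integral do rewrite -sumEFin.
  have EE k w : ((z * A w) ^+ k / k`!%:R)%:E = ((z ^+ k / k`!%:R)%:E * (A w ^+ k)%:E)%E.
    by rewrite exprMn -EFinM mulrAC.
  rewrite integral_sum//; last first.
    move=> k; under eq_fun do rewrite EE.
    by apply: integrableZl => //; exact: moment_integrable.
  apply: eq_bigr => k _; under eq_integral do rewrite EE.
  rewrite integralZl//; last exact: moment_integrable.
  rewrite -{1}(fineK (integrable_fin_num measurableT (moment_integrable k))) -EFinM.
  by congr EFin; rewrite mulrC mulrA mulrAC.
have [] := @dominated_convergence _ _ _ P setT measurableT f_
  (fun w => (expR (z * A w))%:E) (fun w => (dom z w)%:E).
- move=> n; apply/measurable_EFinP; apply: measurable_sum => k.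
  by apply: measurable_funM => //; apply: measurable_funX; exact: measurable_funM.
- by apply/measurable_EFinP; apply: measurableT_comp => //; exact: measurable_funM.
- apply: aeW => w _; apply: cvg_EFin; first exact: nearW.
  exact: is_cvg_series_exp_coeff.
- exact: dom_integrable.
- apply: aeW => w n _; rewrite lee_fin.
  exact: le_trans (series_exp_coeff_le _ _) (expR_norm_le _ _).
move=> _ _; under eq_fun do rewrite fE.
have Ef := fineK (integrable_fin_num measurableT (mgf_integrable zr)).
rewrite -{1}Ef => /fine_cvgP[_]; exact.
Qed.

End MomentsOfMgf.

Theorem theorem2p1 (R : realType) (d : measure_display) (T : measurableType d)
    (P : probability T R) (X Y : R -> {RV P >-> R}) (A : {RV P >-> R})
    (E : nat -> R)
    (hB : brownian_motion2 X Y) (hA : is_levy_area X Y A)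
    (hE : euler_numbers E) (n : nat) :
  ('E_P[fun w => (A w ^+ n)%R] = ((2 ^- n * E n)%R)%:E)%E.
Proof.
have r0 : 0 < 2^-1 :> R by rewrite invr_gt0.
have z1 (z : R) : `|z| <= 2^-1 -> `|2 * z| <= 1.
  by move=> zr; rewrite normrM gtr0_norm// mulrC -ler_pdivlMr// div1r.
have mA : measurable_fun setT A by [].
have fin (z : R) : `|z| <= 2^-1 -> (\int[P]_w (expR (z * A w))%:E < +oo)%E.
  by move=> /z1 zr; rewrite (levy_area_mgf hB hA zr) ltry.
rewrite unlock -(fineK (integrable_fin_num measurableT (moment_integrable mA r0 fin n))).
congr EFin.
have f0 : n`!%:R != 0 :> R by rewrite pnatr_eq0 -lt0n fact_gt0.
apply: (mulIf (invr_neq0 f0)).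
apply: (@pseries_unique R (fun n => fine (\int[P]_w (A w ^+ n)%:E)%E / n`!%:R)
  (fun n => 2 ^- n * E n / n`!%:R) (fun z => (cos (z / 2))^-1)).
- apply/nbhs_ballP; exists 2^-1 => //= z; rewrite /ball/= sub0r normrN => /ltW zr.
  have := mgf_pseries mA r0 fin zr.
  by rewrite (levy_area_mgf hB hA (z1 _ zr)).
(* The generating function of the Euler numbers is evaluated at z/2, which produces the factor
   2^-n. *)
- have half0 : z / 2 @[z --> (0 : R)] --> (0 : R).
    by rewrite -[X in _ --> X](mul0r 2^-1); apply: cvgMr_tmp; exact: cvg_id.
  have : \forall z \near (0 : R),
      pseries (fun n => E n / n`!%:R) (z / 2) @ \oo --> (cos (z / 2))^-1.
    exact: (half0 _ hE).
  apply: filterS => z.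
  have -> // : pseries (fun n => E n / n`!%:R) (z / 2) =
      pseries (fun n => 2 ^- n * E n / n`!%:R) z.
  apply/funext => m; rewrite /pseries /series/=; apply: eq_bigr => i _.
  by rewrite expr_div_n; ring.
Qed.
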